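(* The category $\mathcal{K}_{\mathbb{P}}$, whose single object is $\mathrm{Lsc}([0,1],\overline{\mathbb{N}})$ and whose morphisms are the order-embeddings $\alpha\colon\mathrm{Lsc}([0,1],\overline{\mathbb{N}})\to\mathrm{Lsc}([0,1],\overline{\mathbb{N}})$ such that $\alpha(1)=1$, where $1$ denotes the constant function $1$, is a (Cuntz) Fraïssé category.
   Context: **$\mathrm{Cu}$-semigroups.** For $x,y$ in a partially ordered set, $x\ll y$ means: for every increasing sequence $(z_n)_n$ having a supremum with $y\le\sup_n z_n$, there is $n$ with $x\le z_n$. A $\mathrm{Cu}$-semigroup is a positively ordered (commutative) monoid $S$ such that (O1) every increasing sequence has a supremum; (O2) every element is the supremum of a $\ll$-increasing sequence; (O3) $x'\ll x$ and $y'\ll y$ imply $x'+y'\ll x+y$; (O4) $\sup_n(x_n+y_n)=\sup_n x_n+\sup_n y_n$ for increasing sequences. A $\mathrm{Cu}$-morphism is a monoid morphism preserving the order, the relation $\ll$, and suprema of increasing sequences. $\mathrm{Cu}$ denotes the resulting category. An order-embedding between $\mathrm{Cu}$-semigroups always means a $\mathrm{Cu}$-morphism $\alpha$ such that $\alpha(x)\le\alpha(y)$ implies $x\le y$. $S$ is countably-based if there is a countable subset $B\subseteq S$ such that every element of $S$ is the supremum of a $\ll$-increasing sequence in $B$. With $\overline{\mathbb{N}}=\{0,1,2,\ldots,\infty\}$ and $X$ a compact metric space, $\mathrm{Lsc}(X,\overline{\mathbb{N}})$ is the monoid of lower-semicontinuous functions $X\to\overline{\mathbb{N}}$ with pointwise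 order and addition; it is a $\mathrm{Cu}$-semigroup. **Finite-set comparison.** For $\mathrm{Cu}$-morphisms $\alpha,\beta\colon S\to T$ and a finite set $F\subseteq S$, write $\alpha\simeq_F\beta$ if $\alpha(x')\le\beta(x)$ and $\beta(x')\le\alpha(x)$ for all $x',x\in F$ with $x'\ll x$. **Fraïssé categories.** A subcategory $\mathfrak{c}$ of $\mathrm{Cu}$ is a (Cuntz) Fraïssé category if: - (JEP) for any $A_1,A_2\in\mathfrak{c}$ there is $B\in\mathfrak{c}$ with $\mathrm{Hom}_{\mathfrak{c}}(A_1,B)$ and $\mathrm{Hom}_{\mathfrak{c}}(A_2,B)$ nonempty; - (NAP) for any $\mathfrak{c}$-morphisms $\alpha_1\colon A\to B_1$, $\alpha_2\colon A\to B_2$ and any finite $F\subseteq A$, there are $C\in\mathfrak{c}$ and $\mathfrak{c}$-morphisms $\beta_1\colon B_1\to C$, $\beta_2\colon B_2\to C$ with $\beta_1\circ\alpha_1\simeq_F\beta_2\circ\alpha_2$; - (SEP) there is a subcategory $\mathfrak{s}\subseteq\mathfrak{c}$ whose objects are countably-based, whose set of morphisms is countable, such that every $A\in\mathfrak{c}$ admits a $\mathfrak{c}$-morphism to some $S\in\mathfrak{s}$, and such that for any $\mathfrak{c}$-morphism $\sigma\colon S\to A$ with $S\in\mathfrak{s}$ and any finite $F\subseteq S$ there are $T\in\mathfrak{s}$, $\alpha\in\mathrm{Hom}_{\mathfrak{c}}(A,T)$, $\tau\in\mathrm{Hom}_{\mathfrak{s}}(S,T)$ with $\alpha\circ\sigma\simeq_F\tau$.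 *)

(* Defs.v *)
From HB Require Import structures.
From mathcomp Require Import all_boot all_order all_algebra.
From mathcomp Require Import all_classical all_reals all_analysis.

Set Implicit Arguments.
Unset Strict Implicit.
Unset Printing Implicit Defensive.

Import Order.TTheory GRing.Theory Num.Theory.
Import numFieldNormedType.Exports.

Local Open Scope classical_set_scope.
Local Open Scope ring_scope.

Record pomType := PomType {
  pom_sort :> porderType ring_display ;
  pom0 : pom_sort ;
  pom_add : pom_sort -> pom_sort -> pom_sort ;
  pom_addA : associative pom_add ;
  pom_addC : commutative pom_add ;
  pom_add0 : left_id pom0 pom_add ;
  pom_ge0 : forall x, pom0 <= x ;
  pom_leD2r : forall z x y, x <= y -> pom_add x z <= pom_add y z
}.

Arguments pom0 {_}.
Arguments pom_add {_}.

Definition way_below (S : pomType) (x y : S) : Prop :=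
  forall (z : nat -> S) (s : S),
    nondecreasing_seq z -> isLub (range z) s -> y <= s ->
    exists n, x <= z n.

Definition way_increasing (S : pomType) (u : nat -> S) : Prop :=
  forall n, way_below (u n) (u n.+1).

Record cu_semigroup (S : pomType) : Prop := CuSemigroup {
  cu_O1 : forall u : nat -> S, nondecreasing_seq u ->
    exists s, isLub (range u) s ;
  cu_O2 : forall x : S, exists u : nat -> S,
    way_increasing u /\ isLub (range u) x ;
  cu_O3 : forall x' x y' y : S,
    way_below x' x -> way_below y' y -> way_below (pom_add x' y') (pom_add x y) ;
  cu_O4 : forall (u v : nat -> S) (s t : S),
    nondecreasing_seq u -> nondecreasing_seq v ->
    isLub (range u) s -> isLub (range v) t ->
    isLub (range (fun n => pom_add (u n) (v n))) (pom_add s t)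
}.

Record cu_morphism (S T : pomType) (f : S -> T) : Prop := CuMorphism {
  cu_morph0 : f pom0 = pom0 ;
  cu_morphD : forall x y, f (pom_add x y) = pom_add (f x) (f y) ;
  cu_morph_le : forall x y, x <= y -> f x <= f y ;
  cu_morph_way_below : forall x y, way_below x y -> way_below (f x) (f y) ;
  cu_morph_sup : forall (u : nat -> S) (s : S), nondecreasing_seq u ->
    isLub (range u) s -> isLub (range (f \o u)) (f s)
}.

Definition order_embedding (S T : pomType) (f : S -> T) : Prop :=
  cu_morphism f /\ forall x y, f x <= f y -> x <= y.

Definition countably_based (S : pomType) : Prop :=
  exists2 B : set S, countable B &
    forall x : S, exists u : nat -> S,
      [/\ forall n, B (u n), way_increasing u & isLub (range u) x].

Definition cu_eq_on (S T : pomType) (F : set S) (f g : S -> T) : Prop :=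
  forall x' x, F x' -> F x -> way_below x' x -> f x' <= g x /\ g x' <= f x.

(* A class of objects and a class of maps between their carriers;
   [cu_subcategory] says that these do form a subcategory of Cu. *)
Record subcat := Subcat {
  ob : pomType -> Prop ;
  hom : forall A B : pomType, (A -> B) -> Prop
}.

Record cu_subcategory (c : subcat) : Prop := CuSubcategory {
  subcat_ob : forall A, ob c A -> cu_semigroup A ;
  subcat_hom : forall (A B : pomType) (f : A -> B), hom c f ->
    [/\ ob c A, ob c B & cu_morphism f] ;
  subcat_id : forall A : pomType, ob c A -> hom c (@id A) ;
  subcat_comp : forall (A B C : pomType) (f : A -> B) (g : B -> C),
    hom c f -> hom c g -> hom c (g \o f)
}.

Definition subcat_le (s c : subcat) : Prop :=
  (forall A, ob s A -> ob c A) /\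
  (forall (A B : pomType) (f : A -> B), hom s f -> hom c f).

(* [countable] does not apply: the type of all morphisms is too large for
   [set] universe-wise. *)
Definition countably_many_morphisms (c : subcat) : Prop :=
  exists e : nat -> {A : pomType & {B : pomType & A -> B}},
    forall (A B : pomType) (f : A -> B), hom c f ->
    exists n, e n = existT _ A (existT _ B f).

Definition JEP (c : subcat) : Prop :=
  forall A1 A2, ob c A1 -> ob c A2 ->
  exists B : pomType, [/\ ob c B,
    exists f : A1 -> B, hom c f & exists g : A2 -> B, hom c g].

Definition NAP (c : subcat) : Prop :=
  forall (A B1 B2 : pomType) (a1 : A -> B1) (a2 : A -> B2) (F : set A),
  hom c a1 -> hom c a2 -> finite_set F ->
  exists (C : pomType) (b1 : B1 -> C) (b2 : B2 -> C),
    [/\ ob c C, hom c b1, hom c b2 & cu_eq_on F (b1 \o a1) (b2 \o a2)].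

Definition SEP (c : subcat) : Prop :=
  exists s : subcat,
  [/\ cu_subcategory s /\ subcat_le s c,
      (forall S, ob s S -> countably_based S),
      countably_many_morphisms s,
      (forall A, ob c A ->
        exists (S : pomType) (f : A -> S), ob s S /\ hom c f) &
      (forall (S A : pomType) (sigma : S -> A) (F : set S),
        ob s S -> hom c sigma -> finite_set F ->
        exists (T : pomType) (alpha : A -> T) (tau : S -> T),
          [/\ ob s T, hom c alpha, hom s tau &
              cu_eq_on F (alpha \o sigma) tau])].

Definition fraisse_category (c : subcat) : Prop :=
  [/\ cu_subcategory c, JEP c, NAP c & SEP c].

(* {0, 1, 2, ..., oo} inside the extended reals, from which it takes its order
   and addition. *)
Definition Nbar (R : realType) : set (\bar R) :=
  [set x | x = +oo%E \/ exists n : nat, x = n%:R%:E].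

Record Lsc (R : realType) (X : topologicalType) := MkLsc {
  lsc_fun :> X -> \bar R ;
  lsc_Nbar : forall x, Nbar (lsc_fun x) ;
  lsc_lsc : lower_semicontinuous lsc_fun
}.

Section LscMonoid.
Variables (R : realType) (X : topologicalType).
Implicit Types f g h : Lsc R X.

Lemma lscP f g : (forall x, f x = g x) -> f = g.
Proof.
case: f g => [f fN fl] [g gN gl] /= fg.
have {}fg : f = g by apply/funext.
subst g; congr MkLsc; exact: Prop_irrelevance.
Qed.

Lemma Nbar_ge0 (x : \bar R) : Nbar x -> (0 <= x)%E.
Proof. by case=> [->|[n ->]] //; rewrite lee_fin. Qed.

Lemma Nbar_add (x y : \bar R) : Nbar x -> Nbar y -> Nbar (x + y)%E.
Proof.
case=> [->|[m ->]] [->|[n ->]]; [by left..|right; exists (m + n)%N].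
by rewrite natrD EFinD.
Qed.

Lemma Nbar_cst n (_ : X) : Nbar (n%:R%:E : \bar R).
Proof. by right; exists n. Qed.

Lemma lsc_cst_lsc (c : \bar R) : lower_semicontinuous (fun _ : X => c).
Proof. by move=> x a ac; exists setT => //; exact: filterT. Qed.

Definition lsc_cst n : Lsc R X := MkLsc (Nbar_cst n) (@lsc_cst_lsc n%:R%:E).

Lemma lsc_add_lsc f g : lower_semicontinuous (fun x => f x + g x)%E.
Proof.
have key (h : Lsc R X) x (n : nat) : (n%:R%:E <= h x)%E ->
    nbhs x [set y | (n%:R%:E <= h y)%E].
  case: n => [|n] nh.
    by apply: filterS filterT => y _; exact/Nbar_ge0/lsc_Nbar.
  have [|V xV Vh] := @lsc_lsc _ _ h x n%:R.
    by apply: lt_le_trans nh; rewrite lte_fin ltr_nat.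
  apply: filterS xV => y /Vh /=.
  by case: (lsc_Nbar h y) => [->|[m ->]]; rewrite ?leey// lte_fin lee_fin ltr_nat ler_nat.
have top (h : Lsc R X) x : h x = +oo%E -> forall n : nat, (n%:R%:E <= h x)%E.
  by move=> -> n; rewrite leey.
move=> x a afg.
suff [m [n [mf ng amn]]] : exists m n : nat,
    [/\ (m%:R%:E <= f x)%E, (n%:R%:E <= g x)%E & a < m%:R + n%:R].
  exists ([set y | (m%:R%:E <= f y)%E] `&` [set y | (n%:R%:E <= g y)%E]).
    by apply: filterI; exact: key.
  move=> y [/= mfy ngy]; apply: lt_le_trans (leeD mfy ngy).
  by rewrite -EFinD lte_fin.
have [N aN] : exists N : nat, a < N%:R.
  by exists (Num.bound `|a|); rewrite (le_lt_trans (ler_norm a))// archi_boundP.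
case: (lsc_Nbar f x) afg => [fx _|[m fx]].
  by exists N, 0%N; rewrite addr0; split=> //; [exact: top|exact/Nbar_ge0/lsc_Nbar].
case: (lsc_Nbar g x) => [gx _|[n gx]].
  by exists 0%N, N; rewrite add0r; split=> //; [exact/Nbar_ge0/lsc_Nbar|exact: top].
by rewrite fx gx => afg; exists m, n; rewrite -lte_fin EFinD.
Qed.

Definition lsc_add f g : Lsc R X :=
  MkLsc (fun x => Nbar_add (lsc_Nbar f x) (lsc_Nbar g x)) (@lsc_add_lsc f g).

Definition lsc_le f g : bool := `[< forall x, (f x <= g x)%E >].

HB.instance Definition _ := gen_eqMixin (Lsc R X).
HB.instance Definition _ := gen_choiceMixin (Lsc R X).

Lemma lsc_addA : associative lsc_add.
Proof. by move=> f g h; apply: lscP => x /=; rewrite addeA. Qed.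

Lemma lsc_addC : commutative lsc_add.
Proof. by move=> f g; apply: lscP => x /=; rewrite addeC. Qed.

Lemma lsc_add0 : left_id (lsc_cst 0) lsc_add.
Proof. by move=> f; apply: lscP => x /=; rewrite add0e. Qed.

Lemma lsc_le_refl : reflexive lsc_le.
Proof. by move=> f; apply/asboolP. Qed.

Lemma lsc_le_anti : antisymmetric lsc_le.
Proof.
move=> f g /andP[/asboolP fg /asboolP gf]; apply: lscP => x.
by apply/eqP; rewrite eq_le fg gf.
Qed.

Lemma lsc_le_trans : transitive lsc_le.
Proof.
move=> g f h /asboolP fg /asboolP gh; apply/asboolP => x.
exact: le_trans (fg x) (gh x).
Qed.

HB.instance Definition _ := Order.Le_isPOrder.Build ring_display (Lsc R X)
  lsc_le_refl lsc_le_anti lsc_le_trans.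

Lemma lsc_ge0 f : lsc_cst 0 <= f.
Proof. by apply/asboolP => x; exact/Nbar_ge0/lsc_Nbar. Qed.

Lemma lsc_leD2r h f g : f <= g -> lsc_add f h <= lsc_add g h.
Proof. by move=> /asboolP fg; apply/asboolP => x; exact: leeD. Qed.

Canonical Lsc_pomType : pomType :=
  PomType lsc_addA lsc_addC lsc_add0 lsc_ge0 lsc_leD2r.

End LscMonoid.

Definition unit_interval (R : realType) : set R := `[0, 1]%classic.

Definition LscI (R : realType) : pomType :=
  Lsc_pomType R (set_type (@unit_interval R)).

Inductive KP_hom (R : realType) :
    forall A B : pomType, (A -> B) -> Prop :=
  KPHom (f : LscI R -> LscI R) :
    order_embedding f -> f (lsc_cst R _ 1) = lsc_cst R _ 1 ->
    @KP_hom R (LscI R) (LscI R) f.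

Definition KP (R : realType) : subcat :=
  Subcat (fun A => A = LscI R) (@KP_hom R).

(* Main.v *)
(* Lsc([0,1], Nbar) is dual to [0,1]: a unital order-embedding is the pullback
   along a unique continuous surjection of I = [0,1], because the open sets it
   sends to sets containing a given point t are exactly the neighbourhoods of
   one point.  A relation x' << x amounts to x' being bounded with
   x'(s) <= x(t) for all s, t at distance less than some e, so that
   comparison on a finite set follows from uniform closeness of the surjections.
   (NAP) thus says that for continuous surjections f1, f2 of I there are
   continuous surjections g1, g2 with f1 g1 and f2 g2 uniformly close.
   Precomposing, one may assume that f1 and f2 fix 0 and 1; after discretizing
   them into walks p, q with unit steps this is the mountain climbing theorem:
   in the graph with vertices p i = q j and diagonal edges only the two end
   vertices have odd degree, so they lie in the same component.
   (SEP) holds for the words in the countably many piecewise linear surjections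
   with rational nodes, since these are uniformly dense. *)

Require Import Defs.
From mathcomp Require Import all_boot all_order all_algebra.
From mathcomp Require Import all_classical all_reals all_analysis.
From mathcomp Require Import ring lra zify.

Set Implicit Arguments.
Unset Strict Implicit.
Unset Printing Implicit Defensive.

Import Order.TTheory GRing.Theory Num.Theory.
Import numFieldNormedType.Exports.

Local Open Scope classical_set_scope.
Local Open Scope ring_scope.

(** * Level sets of lower semicontinuous functions *)

Section Levels.
Variables (R : realType) (X : topologicalType).
Implicit Types (f g h : Lsc R X) (k n : nat) (t : X).

(** The inequality is not strict: integrality of the values makes [f t >= k.+1] the open condition
    [f t > k], so order, sums and suprema reduce to natural-number levels on open sets. *)
Definition lv f k t : Prop := (k%:R%:E <= f t)%E.

Lemma lv0 f t : lv f 0 t.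
Proof. exact/Nbar_ge0/lsc_Nbar. Qed.

Lemma lv_le f i k t : (i <= k)%N -> lv f k t -> lv f i t.
Proof. by move=> ik; apply: le_trans; rewrite lee_fin ler_nat. Qed.

Lemma Nbar_gtP (v : \bar R) (a : R) : Nbar v ->
  (a%:E < v)%E <-> exists2 k, (k%:R%:E <= v)%E & a < k%:R.
Proof.
move=> vN; split=> [av|[k kv ak]]; last by rewrite (lt_le_trans _ kv) ?lte_fin.
case: vN av => [->|[n ->]] av; last by exists n.
exists (Num.bound `|a|); first by rewrite leey.
by rewrite (le_lt_trans (ler_norm a))// archi_boundP.
Qed.

(** A finite [v] is itself one of the tested levels. For [v = +oo] the Archimedean property excludes
    a real [w], and level [0] excludes [-oo]. *)
Lemma Nbar_leP (v w : \bar R) : Nbar v ->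
  (forall k, (k%:R%:E <= v)%E -> (k%:R%:E <= w)%E) -> (v <= w)%E.
Proof.
case=> [->|[n ->]] vw; last exact: vw.
case: w vw => [r| |] vw //; last by have := vw 0%N (leey _).
have := vw (Num.bound `|r|) (leey _); rewrite lee_fin leNgt.
by rewrite (le_lt_trans (ler_norm r))// archi_boundP.
Qed.

Lemma lv_nbhs f k t : lv f k t -> nbhs t (lv f k).
Proof.
case: k => [_|k kf]; first by apply: filterS filterT => y _; exact: lv0.
have [|V xV Vh] := @lsc_lsc _ _ f t k%:R.
  by apply: lt_le_trans kf; rewrite lte_fin ltr_nat.
apply: filterS xV => y /Vh; rewrite /lv.
by case: (lsc_Nbar f y) => [->|[m ->]];
  rewrite ?leey// lte_fin lee_fin ltr_nat ler_nat.
Qed.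

Lemma lsc_leP f g : (f <= g :> Lsc_pomType R X) <->
  forall k t, lv f k t -> lv g k t.
Proof.
split=> [/asboolP fg k t kf|fg]; first exact: le_trans kf (fg t).
by apply/asboolP => t; apply: Nbar_leP => [|k]; [exact: lsc_Nbar|exact: fg].
Qed.

Lemma lv_eq f g : (forall k t, lv f k t <-> lv g k t) -> f = g.
Proof.
move=> fg; apply: (@lsc_le_anti R X); apply/andP.
by split; apply/(@lsc_leP _ _) => k t /fg.
Qed.

(** When both values are finite they serve as [i] and [j], hence an inequality between [k] and
    [i + j]; an infinite summand takes all of [k]. *)
Lemma lvD f g k t : lv (lsc_add f g) k t <->
  exists i j, [/\ (k <= i + j)%N, lv f i t & lv g j t].
Proof.
split=> [|[i [j [kij fi gj]]]]; last first.
  rewrite /lv/=; apply: le_trans (leeD fi gj).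
  by rewrite -EFinD lee_fin -natrD ler_nat.
rewrite /lv/=; case: (lsc_Nbar f t) => [->|[m ->]].
  by exists k, 0%N; rewrite addn0 leey; split=> //; exact: lv0.
case: (lsc_Nbar g t) => [->|[n ->]].
  by exists 0%N, k; rewrite leey lee_fin ler_nat.
by rewrite -EFinD lee_fin -natrD ler_nat => kmn; exists m, n.
Qed.

Lemma lv_cst n k t : lv (lsc_cst R X n) k t <-> (k <= n)%N.
Proof. by rewrite /lv/= lee_fin ler_nat. Qed.

(** The value is the supremum of [A]: its maximum when [A] is bounded, [+oo] otherwise. *)
Lemma Nbar_of_cut (A : set nat) : A 0%N -> exists v : \bar R,
  Nbar v /\ forall k, (k%:R%:E <= v)%E <-> exists2 n, A n & (k <= n)%N.
Proof.
move=> A0; have [Ab|/existsNP[K /forallPNP KA]] :=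
    pselect (forall K, exists2 n, A n & (K <= n)%N).
  by exists +oo%E; split=> [|k]; [left|split=> // _; rewrite leey].
have AK : exists n, `[< A n >] by exists 0%N; exact/asboolP.
have Kb n : `[< A n >] -> (n <= K)%N.
  by move=> /asboolP /KA /negP; rewrite -ltnNge => /ltnW.
case: (ex_maxnP AK Kb) => m /asboolP Am mA.
exists m%:R%:E; split=> [|k]; first by right; exists m.
rewrite lee_fin ler_nat; split=> [km|[n An kn]]; first by exists m.
by apply: leq_trans kn _; exact/mA/asboolP.
Qed.

Variable P : nat -> set X.

(** Level [0] is adjoined so that the cut is nonempty at every [t]. *)
Lemma lsc_of_ex t : exists v : \bar R, Nbar v /\ forall k,
  (k%:R%:E <= v)%E <-> exists2 n, n = 0%N \/ interior (P n) t & (k <= n)%N.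
Proof. by apply: Nbar_of_cut; left. Qed.

Definition lsc_of_fun t := projT1 (cid (lsc_of_ex t)).

Lemma lsc_of_Nbar t : Nbar (lsc_of_fun t).
Proof. by rewrite /lsc_of_fun; case: cid => v []. Qed.

Lemma lsc_of_funP t k : (k%:R%:E <= lsc_of_fun t)%E <->
  exists2 n, n = 0%N \/ interior (P n) t & (k <= n)%N.
Proof. by rewrite /lsc_of_fun; case: cid => v []. Qed.

Lemma lsc_of_lsc : lower_semicontinuous lsc_of_fun.
Proof.
move=> t a /(Nbar_gtP a (lsc_of_Nbar t))[k /lsc_of_funP[n nP kn] ak].
exists [set s | n = 0%N \/ interior (P n) s].
  case: nP => [n0|nP]; first by apply: filterS filterT => s _; left.
  by apply: filterS (nbhs_interior nP) => s; right.
move=> s nPs; apply/(Nbar_gtP a (lsc_of_Nbar s)); exists k => //.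
by apply/lsc_of_funP; exists n.
Qed.

(* Total: only the interiors of the [P n] count, so no openness proof is
   needed to form the function. *)
Definition lsc_of : Lsc R X := MkLsc lsc_of_Nbar lsc_of_lsc.

Lemma lv_of k t : (forall n, open (P n)) ->
  lv lsc_of k t <-> k = 0%N \/ exists2 n, P n t & (k <= n)%N.
Proof.
move=> oP; rewrite /lv/= lsc_of_funP; split=> [[n [->|nP] kn]|[->|[n Pn kn]]].
- by left; move: kn; rewrite leqn0 => /eqP.
- by right; exists n => //; exact: interior_subset.
- by exists 0%N; [left|].
- by exists n => //; right; move: (oP n); rewrite openE; apply.
Qed.

End Levels.

(** * Suprema, computed level by level *)

Section Suprema.
Variables (R : realType) (X : topologicalType).
Notation S := (Lsc_pomType R X).
Implicit Types (u v : nat -> S) (s x y : S).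

Lemma lv_open x k : open (lv x k).
Proof. by rewrite openE => t; exact: lv_nbhs. Qed.

Definition lsc_sup u : S := lsc_of R (fun k t => exists n, lv (u n) k t).

Lemma lv_sup u k t : lv (lsc_sup u) k t <-> exists n, lv (u n) k t.
Proof.
rewrite lv_of => [|n]; last first.
  by rewrite openE => s [m mu]; apply: filterS (lv_nbhs mu) => r; exists m.
split=> [[->|[n [m mu] kn]]|[n nu]]; first by exists 0%N; exact: lv0.
  by exists m; exact: lv_le mu.
by right; exists k => //; exists n.
Qed.

(** Since [lsc_sup u] is an upper bound, a least one can have no further levels; suprema thus become
    unions of level sets. *)
Lemma isLub_lvP u s : isLub (range u) s <->
  forall k t, lv s k t <-> exists n, lv (u n) k t.
Proof.
split=> [[us sm] k t|us].
  split=> [ks|[n]].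
    apply/lv_sup; have /lsc_leP : s <= lsc_sup u; last exact.
    by apply: sm => _ [n _ <-]; apply/lsc_leP => i r iu; apply/lv_sup; exists n.
  have /lsc_leP : u n <= s by apply: us; exists n.
  exact.
split=> [_ [n _ <-]|b ub]; first by apply/lsc_leP => k t nk; apply/us; exists n.
apply/lsc_leP => k t /us[n].
have /lsc_leP : u n <= b by apply: ub; exists n.
exact.
Qed.

Lemma lsc_sup_lub u : isLub (range u) (lsc_sup u).
Proof. by apply/isLub_lvP => k t; exact: lv_sup. Qed.

Lemma isLub_add u v s x : nondecreasing_seq u -> nondecreasing_seq v ->
  isLub (range u) s -> isLub (range v) x ->
  isLub (range (fun n => pom_add (u n) (v n))) (pom_add s x).
Proof.
move=> nu nv /isLub_lvP us /isLub_lvP vx; apply/isLub_lvP => k t.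
rewrite lvD; split=> [[i [j [kij /us[m mu] /vx[n nv']]]]|[n /lvD]].
  exists (maxn m n); apply/lvD; exists i, j; split=> //.
    by move: i t mu {kij nv'}; apply/lsc_leP/nu/leq_maxl.
  by move: j t nv' {kij mu}; apply/lsc_leP/nv/leq_maxr.
move=> [i [j [kij ui vj]]]; exists i, j; split=> //.
  by apply/us; exists n.
by apply/vx; exists n.
Qed.

End Suprema.

(** * Compact containment over the unit interval *)

Section UnitInterval.
Variable R : realType.
Notation I := (set_type (@unit_interval R)).
Implicit Types (s t : I) (x y : R).

Definition pt t : R := \val t.

Lemma pt_itv t : 0 <= pt t <= 1.
Proof. by have := set_valP t; rewrite /unit_interval/= in_itv/=. Qed.

Lemma pt_ge0 t : 0 <= pt t. Proof. by have /andP[] := pt_itv t. Qed.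

Lemma pt_le1 t : pt t <= 1. Proof. by have /andP[] := pt_itv t. Qed.

Lemma pt_inj : injective pt. Proof. exact: val_inj. Qed.

(** The retraction of the line onto [[0, 1]], so that every real yields a point of the interval
    without a side condition. Its translates are also the ramps summed in [pl]. *)
Definition clamp x : R := Num.max 0 (Num.min 1 x).

Lemma clamp_itv x : clamp x \in @unit_interval R.
Proof.
rewrite inE /unit_interval/= in_itv/= /clamp le_max lexx/=.
by rewrite ge_max ler01 ge_min lexx.
Qed.

Definition toI x : I := SigSub (clamp_itv x).

Lemma clampK x : 0 <= x <= 1 -> clamp x = x.
Proof. by move=> /andP[x0 x1]; rewrite /clamp min_r// max_r. Qed.

Lemma toIK x : 0 <= x <= 1 -> pt (toI x) = x.
Proof. exact: clampK. Qed.

Lemma ptK t : toI (pt t) = t.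
Proof. by apply: pt_inj; rewrite toIK// pt_itv. Qed.

Lemma clamp_lip x y : `|clamp x - clamp y| <= `|x - y|.
Proof.
rewrite /clamp !maxEle !minEle.
by case: (lerP 1 x) => ?; case: (lerP 1 y) => ?;
  do ![case: ifPn; rewrite -?ltNge => ?]; rewrite ler_norml; apply/andP; split;
  case: (ger0P (x - y)) => ?; lra.
Qed.

Lemma nbhsIP t (A : set I) : nbhs t A <->
  exists2 e, 0 < e & forall s, `|pt t - pt s| < e -> A s.
Proof.
rewrite (@nbhs_ballP R I); split=> -[e e0 eA]; exists e => //.
Qed.

(** Compactness as an induction principle on sets, used in place of finite subcovers. *)
Lemma I_local_global (Q : set I -> Prop) :
  Q set0 -> (forall A B : set I, A `<=` B -> Q B -> Q A) ->
  (forall A B, Q A -> Q B -> Q (A `|` B)) ->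
  (forall t, exists2 A, nbhs t A & Q A) -> Q setT.
Proof.
move=> Q0 Qs QU Qloc.
(* A family is large when it contains all [Q]-sets above some [Q]-set; unions make this a filter.
   Each local neighbourhood is eventually included, so compactness along [F] yields one [Q]-set
   containing every point. *)
pose F : set_system (set I) := fun AA => exists2 A0, Q A0 &
  forall A, Q A -> A0 `<=` A -> AA A.
have FF : Filter F.
  split; first by exists set0.
    move=> P1 P2 [A1 QA1 AP1] [A2 QA2 AP2]; exists (A1 `|` A2); first exact: QU.
    move=> A QA; rewrite subUset => -[A1A A2A].
    by split; [exact: AP1|exact: AP2].
  by move=> P1 P2 P12 [A1 QA1 AP1]; exists A1 => // A QA /(AP1 _ QA)/P12.
have [A0 QA0 A0P] : F (fun A => `[0, 1]%classic `<=` fun x => A (toI x)).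
  have /compact_near_coveringP/(_ _ F (fun A x => A (toI x)) FF) :=
    @segment_compact R 0 1.
  apply=> x x01; have [A /nbhsIP[e e0 eA] QA] := Qloc (toI x).
  exists ([set y | `|x - y| < e], [set B | Q B /\ A `<=` B]) => /=.
    split; first by apply/nbhs_ballP; exists e.
    by exists A.
  move=> [y B]/= [xy [QB AB]]; apply: AB; apply: eA.
  exact: le_lt_trans (clamp_lip _ _) xy.
by apply: (Qs _ A0 _ QA0) => t _; have := A0P _ QA0 (@subset_refl _ _) (pt t);
  rewrite ptK; apply; rewrite /= in_itv/= pt_itv.
Qed.

Definition ucont (f : I -> I) := forall e, 0 < e -> exists2 d, 0 < d &
  forall s t, `|pt s - pt t| < d -> `|pt (f s) - pt (f t)| < e.

Definition surj (f : I -> I) := forall t, exists s, f s = t.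

(** Heine-Cantor: [Q A] asks for one [d] serving all base points in [A], and passes to unions by
    taking minima. Near [t], half of the [d] obtained for [e / 2] works. *)
Lemma continuous_ucont (f : I -> I) :
  (forall t e, 0 < e -> exists2 d, 0 < d &
    forall s, `|pt t - pt s| < d -> `|pt (f t) - pt (f s)| < e) -> ucont f.
Proof.
move=> cf e e0; pose Q (A : set I) := exists2 d, 0 < d &
  forall s t, A s -> `|pt s - pt t| < d -> `|pt (f s) - pt (f t)| < e.
have : Q setT; last by case=> d d0 df; exists d => // s t; exact: df.
apply: I_local_global => [|A B AB [d d0 dB]|A B [d d0 dA] [c c0 cB]|t].
- by exists 1.
- by exists d => // s t /AB; exact: dB.
- exists (Num.min d c); first by rewrite lt_min d0.
  move=> s t [As|Bs]; rewrite lt_min => /andP[sd sc]; [exact: dA|exact: cB].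
- have e20 : 0 < e / 2 by lra.
  have [d d0 df] := cf t _ e20; exists [set s | `|pt t - pt s| < d / 2].
    by apply/nbhsIP; exists (d / 2) => //; lra.
  exists (d / 2) => [|r s /= tr rs]; first by lra.
  have h1 : `|pt t - pt r| < d by lra.
  have h2 : `|pt t - pt s| < d.
    by apply: le_lt_trans (ler_distD (pt r) _ _) _; lra.
  have := df _ h1; have := df _ h2 => f2 f1.
  by apply: le_lt_trans (ler_distD (pt (f t)) _ _) _; rewrite (distrC _ (pt (f t))); lra.
Qed.

Lemma ucont_comp f g : ucont f -> ucont g -> ucont (f \o g).
Proof.
by move=> cf cg e /cf[d /cg[c c0 cd] de]; exists c => // s t /cd /de.
Qed.

Lemma surj_comp f g : surj f -> surj g -> surj (f \o g).
Proof. by move=> sf sg t; have [s <-] := sf t; have [r <-] := sg s; exists r. Qed.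

Lemma grid_near N t : (0 < N)%N ->
  exists2 j, (j <= N)%N & `|pt t - j%:R / N%:R| < N%:R^-1.
Proof.
move=> N0; have N0' : 0 < N%:R :> R by rewrite ltr0n.
have h0 : 0 <= pt t * N%:R by rewrite mulr_ge0// pt_ge0.
exists (Num.truncn (pt t * N%:R)).
  rewrite truncn_le_nat (@le_lt_trans _ _ N%:R)// ?ltr_nat//.
  by rewrite -[leRHS]mul1r ler_pM2r// pt_le1.
have /andP[l1 l2] := truncn_itv h0; rewrite -natr1 in l2.
set j := _%:R in l1 l2 *.
have -> : pt t - j / N%:R = (pt t * N%:R - j) / N%:R.
  by rewrite mulrBl mulfK// gt_eqF.
rewrite normrM normfV (ger0_norm (ltW N0')) -[ltRHS]mul1r ltr_pM2r ?invr_gt0//.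
by rewrite ltr_norml; apply/andP; split; lra.
Qed.

End UnitInterval.

Arguments clamp {R}.
Arguments toI {R}.

(** * A countable basis and the way-below relation *)

Section Approximants.
Variable R : realType.
Notation I := (set_type (@unit_interval R)).
Notation S := (LscI R).
Implicit Types (s t : I) (x y : S).

Definition grid_set N (L : seq (nat * nat)) (k : nat) : set I :=
  [set t | exists2 j, (k, j) \in L & `|pt t - j%:R / N%:R| < 2 / N%:R].

Definition grid_lsc N L : S := lsc_of R (grid_set N L).

Lemma grid_set_open N L k : open (grid_set N L k).
Proof.
rewrite openE => t [j jL tj]; apply/nbhsIP.
exists (2 / N%:R - `|pt t - j%:R / N%:R|) => [|s ts]; first by lra.
exists j => //; apply: le_lt_trans (ler_distD (pt t) _ _) _.
by rewrite distrC; lra.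
Qed.

(** With mesh [c = 5 ^ -n], a node is accepted when its ball of radius [5c] lies in the level set,
    but only radius [2c] is drawn. The slack [3c] absorbs a shift by [c], the distance [c / 5] to a
    node of the next mesh, and the radius [c] required there. *)
Definition approx_list x n : seq (nat * nat) :=
  [seq p <- allpairs pair (iota 0 n.+1) (iota 0 (5 ^ n).+1) |
    `[< forall s, `|pt s - p.2%:R / (5 ^ n)%:R| < 5 / (5 ^ n)%:R -> lv x p.1 s >]].

Definition approx x n : S := grid_lsc (5 ^ n) (approx_list x n).

Lemma lv_approx x n k t : lv (approx x n) k t <-> k = 0%N \/
  (k <= n)%N /\ exists j, [/\ (j <= 5 ^ n)%N,
    `|pt t - j%:R / (5 ^ n)%:R| < 2 / (5 ^ n)%:R &
    forall s, `|pt s - j%:R / (5 ^ n)%:R| < 5 / (5 ^ n)%:R -> lv x k s].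
Proof.
rewrite lv_of; last by move=> i; exact: grid_set_open.
split=> [[->|[i [j]]]|[->|[kn [j [jN tj jx]]]]]; [by left| |by left|].
  rewrite mem_filter => /andP[/asboolP jx /allpairsP[[i' j'] []]].
  rewrite !mem_iota !add0n !ltnS !leq0n => i'n j'n [ii' jj'] tj ki.
  subst i' j'; right; split; first exact: leq_trans ki _.
  by exists j; split=> // s /jx; exact: lv_le.
right; exists k => //; exists j => //.
rewrite mem_filter; apply/andP; split; first exact/asboolP.
apply/allpairsP; exists (k, j); split=> //.
  by rewrite mem_iota add0n ltnS.
by rewrite mem_iota add0n ltnS.
Qed.

Definition gap (e : R) x y :=
  forall k s t, `|pt s - pt t| < e -> lv x k s -> lv y k t.

Lemma gap_le e x y : 0 < e -> gap e x y -> x <= y.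
Proof.
by move=> e0 xy; apply/lsc_leP => k t; apply: xy; rewrite subrr normr0.
Qed.

Lemma gap_leW (e : R) x y z : gap e x y -> y <= z -> gap e x z.
Proof. by move=> xy /lsc_leP yz k s t st xs; exact/yz/(xy _ s). Qed.

Lemma natr5X_gt0 n : 0 < (5 ^ n)%:R :> R.
Proof. by rewrite ltr0n expn_gt0. Qed.

Lemma approx_gap x n : gap (5 ^ n)%:R^-1 (approx x n) (approx x n.+1).
Proof.
move=> k s t st /lv_approx[->|[kn [j [jN sj jx]]]]; first exact: lv0.
apply/lv_approx; right; split; first exact: leqW.
have [|j' j'N tj'] := @grid_near R (5 ^ n.+1) t; first by rewrite expn_gt0.
have := natr5X_gt0 n; rewrite -invr_gt0.
have E : (5 ^ n.+1)%:R^-1 = (5 ^ n)%:R^-1 / 5 :> R.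
  by rewrite expnS natrM invfM mulrC.
rewrite E in tj' *; set c := (5 ^ n)%:R^-1 in st sj jx tj' *.
move=> c0; exists j'; split=> // [|r rj']; first by lra.
apply: jx; apply: le_lt_trans (ler_distD (pt s) _ _) _.
apply: (@lt_le_trans _ _ (3 * c + 2 * c)); last by lra.
apply: ltrD => //; apply: le_lt_trans (ler_distD (pt t) _ _) _.
rewrite (distrC (pt t)).
have := ler_distD (j'%:R * (c / 5)) (pt r) (pt t).
by rewrite (distrC (_ * _) (pt t)); lra.
Qed.

Lemma approx_le_bound x n k t : lv (approx x n) k t -> (k <= n)%N.
Proof. by move=> /lv_approx[->|[]]. Qed.

Lemma approx_lub x : isLub (range (approx x)) x.
Proof.
apply/isLub_lvP => k t; split=> [kx|[n /lv_approx[->|[kn [j [_ tj jx]]]]]].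
- have /nbhsIP[e e0 ex] := lv_nbhs kx.
  (* In mesh units, [6] is the acceptance radius [5] plus the distance, below [1], from [t] to a
     node. Levels above [n] are cut off, hence the [maxn] with [k]. *)
  pose n := maxn k (Num.bound (6 / e)); exists n.
  have nb : 6 / e < (5 ^ n)%:R.
    apply: (@lt_trans _ _ n%:R); last by rewrite ltr_nat ltn_expl.
    apply: (@lt_le_trans _ _ (Num.bound (6 / e))%:R).
      by rewrite archi_boundP// divr_ge0// ltW.
    by rewrite ler_nat leq_maxr.
  have ne : 6 / (5 ^ n)%:R < e.
    by rewrite ltr_pdivrMr ?natr5X_gt0// mulrC -ltr_pdivrMr.
  have c0 : 0 < (5 ^ n)%:R^-1 :> R by rewrite invr_gt0 natr5X_gt0.
  apply/lv_approx; right; split; first exact: leq_maxl.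
  have [|j jN tj] := @grid_near R (5 ^ n) t; first by rewrite expn_gt0.
  exists j; split=> // [|s sj]; first by lra.
  apply: ex; apply: le_lt_trans (ler_distD (j%:R / (5 ^ n)%:R) _ _) _.
  by rewrite (distrC _ (pt s)); lra.
- exact: lv0.
- by apply: jx; have := natr5X_gt0 n; rewrite -invr_gt0; lra.
Qed.

Lemma approx_nondecreasing x : nondecreasing_seq (approx x).
Proof.
apply/nondecreasing_seqP => n; apply: gap_le (@approx_gap x n).
by rewrite invr_gt0 natr5X_gt0.
Qed.

(** Forward, [x] is tested against the approximants of [y], which are bounded and have a gap to the
    next one. Backward, compactness reduces to finding an index near each point. *)
Lemma way_belowP x y : way_below x y <->
  exists e K, [/\ 0 < e, gap e x y & forall k t, lv x k t -> (k <= K)%N].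
Proof.
split=> [|[e [K [e0 xy xK]]] z s nz /isLub_lvP zs /lsc_leP ys].
  move=> /(_ _ _ (@approx_nondecreasing y) (approx_lub y) (lexx _))[n xn].
  exists (5 ^ n)%:R^-1, n; split=> [||k t kx].
  - by rewrite invr_gt0 natr5X_gt0.
  - have ay : approx y n.+1 <= y by apply: (approx_lub y).1; exists n.+1.
    apply: gap_leW ay => k r t rt.
    by move/lsc_leP: xn => /[apply]; exact: approx_gap.
  - by apply: (@approx_le_bound y n k t); move/lsc_leP: xn; exact.
pose Q (A : set I) := exists n, forall k t, A t -> lv x k t -> lv (z n) k t.
suff : Q setT by move=> [n nz']; exists n; apply/lsc_leP => k t; exact: nz'.
apply: I_local_global => [|A B AB [n nB]|A B [n nA] [m mB]|t].
- by exists 0%N.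
- by exists n => k t /AB; exact: nB.
- exists (maxn n m) => k t [At|Bt] kt.
    have /lsc_leP : z n <= z (maxn n m) by apply/nz/leq_maxl.
    by apply; exact: nA.
  have /lsc_leP : z m <= z (maxn n m) by apply/nz/leq_maxr.
  by apply; exact: mB.
(* Only the highest level [m] that [x] reaches within [e] of [t] matters; it exists because of the
   bound [K]. By the gap [y] has level [m] at [t], so some [z n] has it on a neighbourhood. *)
pose W k := `[< exists2 r : I, `|pt r - pt t| < e & lv x k r >].
have W0 : exists k, W k.
  by exists 0%N; apply/asboolP; exists t; [rewrite subrr normr0|exact: lv0].
have WK k : W k -> (k <= K)%N by move=> /asboolP[r _ /xK].
case: (ex_maxnP W0 WK) => m /asboolP[r rt mr] mW.
have /zs[n mn] : lv s m t by exact/ys/(xy _ _ _ rt).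
exists ([set q | `|pt t - pt q| < e] `&` lv (z n) m).
  by apply: filterI; [apply/nbhsIP; exists e|exact: lv_nbhs].
exists n => k q [/= tq zq] kq; apply: lv_le zq.
by apply: mW; apply/asboolP; exists q => //; rewrite distrC.
Qed.

Lemma approx_way_below x n : way_below (approx x n) (approx x n.+1).
Proof.
apply/way_belowP; exists (5 ^ n)%:R^-1, n; split; last exact: approx_le_bound.
  by rewrite invr_gt0 natr5X_gt0.
exact: approx_gap.
Qed.

Lemma LscI_cu_semigroup : cu_semigroup S.
Proof.
split=> [u _|x|x' x y' y|u v s t]; first by exists (lsc_sup u); exact: lsc_sup_lub.
- exists (approx x); split; last exact: approx_lub.
  by move=> n; exact: approx_way_below.
- move=> /way_belowP[e [K [e0 xe xK]]] /way_belowP[d [M [d0 yd yM]]].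
  apply/way_belowP; exists (Num.min e d), (K + M)%N; split.
  + by rewrite lt_min e0.
  + move=> k s t; rewrite lt_min => /andP[st1 st2] /lvD[i [j [kij si sj]]].
    apply/lvD; exists i, j; split=> //; [exact: xe si|exact: yd sj].
  + move=> k t /lvD[i [j [kij /xK iK /yM jM]]].
    by apply: leq_trans kij _; exact: leq_add.
- exact: isLub_add.
Qed.

Lemma LscI_countably_based : countably_based S.
Proof.
exists (range (fun p : nat * seq (nat * nat) => grid_lsc p.1 p.2)).
  by apply: card_le_trans (card_image_le _ _) _; exact: countableP.
move=> x; exists (approx x); split; last exact: approx_lub.
  by move=> n; exists ((5 ^ n)%N, approx_list x n).
by move=> n; exact: approx_way_below.
Qed.

(** Minimum over the finitely many pairs, those not related by [way_below] imposing nothing. A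
    comparison on [F] thereby gets a single tolerance. *)
Lemma finite_gap (F : set S) : finite_set F -> exists2 e, 0 < e &
  forall x' x, F x' -> F x -> way_below x' x -> gap e x' x.
Proof.
move=> /finite_seqP[l ->].
suff [e e0 el] : exists2 e, 0 < e & forall p, p \in allpairs pair l l ->
    way_below p.1 p.2 -> gap e p.1 p.2.
  exists e => // x' x /= lx' lx; apply: (el (x', x)).
  by apply/allpairsP; exists (x', x).
elim: (allpairs _ _ _) => [|[x' x] r [e e0 er]]; first by exists 1.
have [/[dup] w /way_belowP[d [K [d0 dx _]]]|nw] := pselect (way_below x' x).
  exists (Num.min e d); first by rewrite lt_min e0.
  move=> p; rewrite inE => /predU1P[->/= _|pr pw] k s t; rewrite lt_min => /andP[? ?].
    exact: dx.
  exact: er.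
by exists e => // p; rewrite inE => /predU1P[-> //|]; exact: er.
Qed.

End Approximants.

(** * Order-embeddings as pullbacks *)

Section Pullback.
Variable R : realType.
Notation I := (set_type (@unit_interval R)).
Notation S := (LscI R).
Implicit Types (s t : I) (x y : S) (h : I -> I).

(** The composite of [x] with [h] when [h] is continuous; going through [lsc_of] defines it for
    every [h]. *)
Definition pull h x : S := lsc_of R (fun k t => lv x k (h t)).

Lemma lv_pull h x k t : ucont h -> lv (pull h x) k t <-> lv x k (h t).
Proof.
move=> ch; rewrite lv_of => [|n].
  split=> [[->|[n nx kn]]|kx]; [exact: lv0|exact: lv_le nx|right].
  by exists k.
rewrite openE => s /lv_nbhs/nbhsIP[e /ch[d d0 de] ex].
by apply/nbhsIP; exists d => // r /de; exact: ex.
Qed.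

(** Uniform continuity pulls a gap back to a gap, which preserves [way_below]; surjectivity reflects
    the order. *)
Lemma pull_embedding h : ucont h -> surj h -> order_embedding (pull h).
Proof.
move=> ch sh; split; last first.
  move=> x y /lsc_leP xy; apply/lsc_leP => k t; have [s <-] := sh t.
  by move=> /(lv_pull _ _ _ ch)/xy/(lv_pull _ _ _ ch).
split.
- by apply: lv_eq => k t; rewrite lv_pull// !lv_cst.
- move=> x y; apply: lv_eq => k t; rewrite lv_pull// !lvD.
  by split=> -[i [j [? ? ?]]]; exists i, j; split=> //; apply/lv_pull.
- move=> x y /lsc_leP xy; apply/lsc_leP => k t /(lv_pull _ _ _ ch)/xy.
  by move=> ?; apply/lv_pull.
- move=> x y /way_belowP[e [K [/ch[d d0 de] xy xK]]].
  apply/way_belowP; exists d, K; split=> // [k s t|k t].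
    by move=> /de/xy/[swap]; rewrite !lv_pull// => ? /(_ k); exact.
  by rewrite lv_pull//; exact: xK.
- move=> u s nu /isLub_lvP us; apply/isLub_lvP => k t; rewrite lv_pull// us.
  by split=> -[n ?]; exists n; apply/lv_pull.
Qed.

Lemma pull_cst h n : ucont h -> pull h (lsc_cst R _ n) = lsc_cst R _ n.
Proof. by move=> ch; apply: lv_eq => k t; rewrite lv_pull// !lv_cst. Qed.

Definition ind (U : set I) : S := lsc_of R (fun k t => (k <= 1)%N /\ U t).

Lemma lv_ind U k t : open U -> lv (ind U) k t <-> k = 0%N \/ k = 1%N /\ U t.
Proof.
move=> oU; rewrite lv_of => [|n].
  split=> [[->|[n [n1 Ut] kn]]|[->|[-> Ut]]]; [by left| |by left|]; last first.
    by right; exists 1%N.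
  by case: k kn => [|[|k]] kn; [left|right|lia].
rewrite openE => s [n1 Us].
by move: (oU); rewrite openE => /(_ _ Us); apply: filterS.
Qed.

Definition trunc n x : S := lsc_of R (fun k t => (k <= n)%N /\ lv x k t).

Lemma lv_trunc n x k t : lv (trunc n x) k t <-> (k <= n)%N /\ lv x k t.
Proof.
rewrite lv_of => [|m].
  split=> [[->|[m [mn mx] km]]|kx]; first by split=> //; exact: lv0.
    by split; [exact: leq_trans mn|exact: lv_le mx].
  by right; exists k.
by rewrite openE => s [mn /lv_nbhs]; apply: filterS.
Qed.

(** Layer-cake decomposition: with [trunc_lub], a map preserving sums and suprema is determined by
    its values on indicators of open sets. *)
Lemma truncS n x : trunc n.+1 x = lsc_add (trunc n x) (ind (lv x n.+1)).
Proof.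
apply: lv_eq => k t; rewrite lv_trunc lvD; split=> [[kn kx]|].
  move: kn; rewrite leq_eqVlt => /predU1P[kE|kn].
    rewrite kE in kx *; exists n, 1%N; rewrite addn1; split=> //.
      by apply/lv_trunc; split=> //; exact: lv_le kx.
    by apply/lv_ind; [exact: lv_open|right].
  by exists k, 0%N; rewrite addn0; split=> //; [exact/lv_trunc|exact: lv0].
move=> [i [j [kij /lv_trunc[ni ix] /(lv_ind _ _ (@lv_open _ _ _ _))]]].
move=> [j0|[j1 nx]].
  by split; [lia|apply: lv_le ix; lia].
by split; [lia|apply: lv_le nx; lia].
Qed.

Lemma trunc_nondecreasing x : nondecreasing_seq (trunc^~ x).
Proof.
move=> m n mn; apply/lsc_leP => k t /lv_trunc[km kx]; apply/lv_trunc.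
by split=> //; exact: leq_trans mn.
Qed.

Lemma trunc_lub x : isLub (range (trunc^~ x)) x.
Proof.
apply/isLub_lvP => k t; split=> [kx|[n /lv_trunc[]]//].
by exists k; apply/lv_trunc.
Qed.

Lemma ball_open t e : open [set s : I | `|pt t - pt s| < e].
Proof.
rewrite openE => s /= ts; apply/nbhsIP; exists (e - `|pt t - pt s|); first by lra.
by move=> r /= sr; apply: le_lt_trans (ler_distD (pt s) _ _) _; lra.
Qed.

(** * The point map of a unital order-embedding *)

Section Dual.
Variable a : S -> S.
Hypotheses (ae : order_embedding a) (a1 : a (lsc_cst R _ 1) = lsc_cst R _ 1).

Let aD x y : a (lsc_add x y) = lsc_add (a x) (a y).
Proof. exact: (cu_morphD ae.1). Qed.

Let a_le x y k t : x <= y -> lv (a x) k t -> lv (a y) k t.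
Proof. by move=> /(cu_morph_le ae.1)/lsc_leP; exact. Qed.

Let a_sup u x k t : nondecreasing_seq u -> isLub (range u) x ->
  lv (a x) k t <-> exists n, lv (a (u n)) k t.
Proof.
by move=> nu /(cu_morph_sup ae.1 nu)/isLub_lvP; apply.
Qed.

Let a_cst1 U : open U -> ind U <= lsc_cst R _ 1 :> S.
Proof.
move=> oU; apply/lsc_leP => k t /(lv_ind _ _ oU)[->|[-> _]]; exact/lv_cst.
Qed.

(* Otherwise [I] would be covered by finitely many open [U] whose images under
   [a] miss [t], contradicting [a 1 = 1]. *)
Lemma dual_point_ex t : exists p : I, forall U, open U -> U p -> lv (a (ind U)) 1 t.
Proof.
apply: contrapT => /forallNP np.
pose Q (B : set I) := exists U, [/\ open U, B `<=` U & ~ lv (a (ind U)) 1 t].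
have : Q setT.
  apply: I_local_global => [|A B AB [U [oU BU nU]]|A B|p].
  - exists set0; split=> //; first exact: open0.
    have /a_le : ind set0 <= pom0 :> S.
      by apply/lsc_leP => k s /(lv_ind _ _ (@open0 _))[->|[]//]; exact: lv0.
    by move=> /(_ 1%N t) + /[dup] => /[apply] /[swap] _; rewrite (cu_morph0 ae.1) lv_cst.
  - by exists U; split=> //; exact: subset_trans BU.
  - move=> [U [oU AU nU]] [V [oV BV nV]]; exists (U `|` V); split.
    + exact: openU.
    + by move=> s [/AU|/BV]; [left|right].
    + have oUV : open (U `|` V) by exact: openU.
      have /a_le : ind (U `|` V) <= lsc_add (ind U) (ind V) :> S.
        apply/lsc_leP => k s /(lv_ind _ _ oUV)[->|[-> [Us|Vs]]]; first exact: lv0.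
          apply/lvD; exists 1%N, 0%N; split=> //; last exact: lv0.
          by apply/lv_ind => //; right.
        apply/lvD; exists 0%N, 1%N; split=> //; first exact: lv0.
        by apply/lv_ind => //; right.
      move=> /[apply]; rewrite aD => /lvD[i [j [ij iU jV]]].
      have [i1|i0] := leqP 1 i; first by apply: nU; exact: lv_le iU.
      by apply: nV; apply: lv_le jV; lia.
  - have /existsNP[U /not_implyP[oU /not_implyP[Up nU]]] := np p.
    exists U; last by exists U; split.
    by move: (oU); rewrite openE; exact.
move=> [U [oU TU nU]]; apply: nU; apply: (@a_le (lsc_cst R _ 1)).
  apply/lsc_leP => k s; rewrite lv_cst => k1; apply/lv_ind => //.
  by case: k k1 => [|[|]]//; [left|right; split=> //; exact: TU].
by rewrite a1; exact/lv_cst.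
Qed.

Definition dual t : I := projT1 (cid (dual_point_ex t)).

(** If [a (ind U)] reached [t] while [p] is outside [U], some approximant [w] of [ind U] would have
    [a w] reach [t]. By the gap, [w] vanishes on a ball [V] about [p], so [w + ind V <= 1]; applying
    [a] gives [2 <= 1] at [t]. *)
Lemma dualP U t : open U -> lv (a (ind U)) 1 t <-> U (dual t).
Proof.
rewrite /dual; case: cid => /= p pU oU; split=> [|/pU]; last exact.
move=> /(a_sup _ _ (@approx_nondecreasing _ (ind U)) (approx_lub (ind U)))[n wt].
apply: contrapT => nUp.
set w := approx _ n in wt.
have gw := gap_leW (@approx_gap _ (ind U) n)
  ((approx_lub (ind U)).1 _ (ex_intro2 _ _ n.+1 Logic.I erefl)).
set e := _^-1 in gw.
have e0 : 0 < e by rewrite invr_gt0 natr5X_gt0.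
have oV := @ball_open p e; set V := [set s | _] in oV.
have Vt : lv (a (ind V)) 1 t by apply: pU => //; rewrite /V/= subrr normr0.
have : lsc_add w (ind V) <= lsc_cst R _ 1 :> S.
  apply/lsc_leP => k s /lvD[i [j [kij iw]]]; rewrite lv_ind// lv_cst.
  have i1 : (i <= 1)%N.
    by move/lsc_leP: (gap_le e0 gw) => /(_ _ _ iw) /(lv_ind _ _ oU)[->|[->]].
  move=> [j0|[j1]]; first by lia.
  rewrite /V/= distrC => sp; have /(lv_ind _ _ oU)[i0|[]//] := gw _ _ _ sp iw.
  by lia.
move=> /(@a_le _ _ 2%N t); rewrite a1 aD lv_cst => h.
have : (2 <= 1)%N by apply: h; apply/lvD; exists 1%N, 1%N.
by [].
Qed.

(** By [dualP], the preimage of a ball is the first level set of the image of its indicator, hence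
    open. *)
Lemma dual_ucont : ucont dual.
Proof.
apply: continuous_ucont => t e e0.
have /(dualP _ (@ball_open _ _)) : [set s | `|pt (dual t) - pt s| < e] (dual t).
  by rewrite /= subrr normr0.
move=> /lv_nbhs/nbhsIP[d d0 dU]; exists d => // s /dU.
by move=> /(dualP _ (@ball_open _ _)).
Qed.

(** Indicators come from [dualP], where levels above [1] are excluded by [a 1 = 1]; then finite sums
    by [truncS], and suprema by [trunc_lub]. *)
Lemma lv_dual x k t : lv (a x) k t <-> lv x k (dual t).
Proof.
have lvi U j : open U -> lv (a (ind U)) j t <-> lv (ind U) j (dual t).
  move=> oU; rewrite lv_ind//; case: j => [|[|j]].
  - by split=> _; [left|exact: lv0].
  - by rewrite dualP//; split=> [|[//|[]//]]; right.
  - split=> [|[//|[]//]].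
    by move=> /(a_le (a_cst1 oU)); rewrite a1 lv_cst.
have lvt n j : lv (a (trunc n x)) j t <-> lv (trunc n x) j (dual t).
  elim: n j => [|n IH] j; last first.
    rewrite truncS aD !lvD; split=> -[i [l [jil h1 h2]]]; exists i, l; split=> //.
    - exact/IH.
    - by apply/lvi => //; exact: lv_open.
    - exact/IH.
    - by apply/lvi => //; exact: lv_open.
  have -> : trunc 0 x = pom0 :> S.
    apply: lv_eq => i s; rewrite lv_trunc lv_cst leqn0.
    by split=> [[]//|/eqP->]; split=> //; exact: lv0.
  by rewrite (cu_morph0 ae.1) !lv_cst.
rewrite (a_sup _ _ (trunc_nondecreasing x) (trunc_lub x)).
split=> [[n /lvt/lv_trunc[]//]|kx].
by exists k; apply/lvt/lv_trunc.
Qed.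

(** If [p] were missed, [a] would send the indicator of the complement of [p] above [1]; reflecting
    the order contradicts its vanishing at [p]. *)
Lemma dual_surj : surj dual.
Proof.
move=> p; apply: contrapT => /forallNP np.
have oU : open [set s : I | s <> p].
  rewrite openE => s /= sp; apply/nbhsIP; exists `|pt s - pt p|.
    rewrite normr_gt0 subr_eq0; apply/eqP => /pt_inj; exact: sp.
  by move=> r sr rp; rewrite rp ltxx in sr.
have /ae.2/lsc_leP/(_ 1%N p) : a (lsc_cst R _ 1) <= a (ind [set s | s <> p]).
  apply/lsc_leP => k t; rewrite lv_dual lv_cst => k1; apply/lv_dual/lv_ind => //.
  by case: k k1 => [|[|]]//; [left|right; split=> //; exact: np].
by rewrite lv_cst lv_ind// => /(_ isT)[//|[_]]; exact.
Qed.

End Dual.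

End Pullback.

(** * Piecewise linear maps *)

Section Interpolation.
Variable R : realType.
Notation I := (set_type (@unit_interval R)).
Implicit Types (v : nat -> R) (x y : R) (t : I).

Lemma clamp_le0 x : x <= 0 -> clamp x = 0.
Proof. by move=> x0; rewrite /clamp max_l// ge_min x0 orbT. Qed.

Lemma clamp_ge1 x : 1 <= x -> clamp x = 1.
Proof. by move=> x1; rewrite /clamp min_l// max_r. Qed.

(** Linear interpolation of the points [(i, v i)] for [i <= T], constant outside, written as a sum
    of ramps so that the Lipschitz bound is an induction on [T]. *)
Definition pl v T x := v 0%N + \sum_(i < T) (v i.+1 - v i) * clamp (x - i%:R).

Lemma plS v T x : pl v T.+1 x = pl v T x + (v T.+1 - v T) * clamp (x - T%:R).
Proof. by rewrite /pl big_ord_recr/= addrA. Qed.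

Lemma pl_above v k x : k%:R <= x -> pl v k x = v k.
Proof.
elim: k => [|k IH]; first by rewrite /pl big_ord0 addr0.
rewrite -natr1 => kx; rewrite plS IH; last by lra.
by rewrite clamp_ge1; [ring|lra].
Qed.

Lemma pl_seg v T k x : (k < T)%N -> k%:R <= x <= k%:R + 1 ->
  pl v T x = v k + (v k.+1 - v k) * (x - k%:R).
Proof.
move=> + /andP[kx xk]; elim: T => // T IH; rewrite ltnS leq_eqVlt.
rewrite plS => /predU1P[<-|kT]; last first.
  rewrite IH// clamp_le0 ?mulr0 ?addr0//.
  by move: kT; rewrite -(ler_nat R) -natr1; lra.
rewrite clampK; last by lra.
by rewrite pl_above.
Qed.

Lemma pl_lip v T : exists2 L, 0 < L & forall x y, `|pl v T x - pl v T y| <= L * `|x - y|.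
Proof.
elim: T => [|T [L L0 IH]].
  by exists 1 => // x y; rewrite /pl !big_ord0 subrr normr0 mul1r.
exists (L + `|v T.+1 - v T|) => [|x y]; first by rewrite ltr_pwDl.
rewrite !plS opprD addrACA -mulrBr [leRHS]mulrDl.
apply: le_trans (ler_normD _ _) _; apply: lerD => //; rewrite normrM.
apply: ler_wpM2l => //; apply: le_trans (clamp_lip _ _) _.
by rewrite opprB addrA subrK.
Qed.

Definition plI v T t : I := toI (pl v T (T%:R * pt t)).

Lemma plI_ucont v T : ucont (plI v T).
Proof.
(* [T.+1] keeps the denominator positive when [T = 0]. *)
have [L L0 HL] := pl_lip v T => e e0; exists (e / (L * T.+1%:R)).
  by rewrite divr_gt0// mulr_gt0// ltr0n.
move=> s t; rewrite ltr_pdivlMr ?mulr_gt0 ?ltr0n// => st.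
apply: le_lt_trans (clamp_lip _ _) _; apply: le_lt_trans (HL _ _) _.
rewrite -mulrBr normrM (ger0_norm (ler0n _ _)); apply: le_lt_trans st.
rewrite mulrA mulrC ler_wpM2l// ler_wpM2l ?(ltW L0)// ler_nat//.
Qed.

Lemma seg_index T t : (0 < T)%N ->
  exists2 k, (k < T)%N & k%:R <= T%:R * pt t <= k%:R + 1.
Proof.
case: T => // T _.
have := pt_ge0 t; have := pt_le1 t => t1 t0.
have h0 : 0 <= T.+1%:R * pt t by rewrite mulr_ge0.
have /andP[l1 l2] := truncn_itv h0.
have [kT|kT] := ltnP (Num.truncn (T.+1%:R * pt t)) T.+1.
  by exists (Num.truncn (T.+1%:R * pt t)) => //; rewrite l1 natr1 ltW.
(* Only the right end point [1] arrives here; it belongs to the last segment. *)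
exists T => //; rewrite natr1; apply/andP; split; last by rewrite ler_piMr.
by apply: le_trans l1; rewrite ler_nat ltnW.
Qed.

(** Convex combinations of nodes in [[0, 1]] stay there, so the clamping in [plI] has no effect. *)
Lemma plI_seg v T k t : (forall i, (i <= T)%N -> 0 <= v i <= 1) ->
  (k < T)%N -> k%:R <= T%:R * pt t <= k%:R + 1 ->
  pt (plI v T t) = v k + (v k.+1 - v k) * (T%:R * pt t - k%:R).
Proof.
move=> v01 kT tk.
have l01 : 0 <= T%:R * pt t - k%:R <= 1 by lra.
have /andP[a0 a1] := v01 _ (ltnW kT); have /andP[b0 b1] := v01 _ kT.
rewrite toIK (pl_seg _ kT)//; move: (_ - k%:R) l01 => l /andP[l0 l1].
by apply/andP; split; nra.
Qed.

Lemma grid_itv T k : (0 < T)%N -> (k <= T)%N -> 0 <= (k%:R / T%:R : R) <= 1.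
Proof.
by move=> T0 kT; rewrite divr_ge0//= ler_pdivrMr ?ltr0n// mul1r ler_nat.
Qed.

Lemma pl_at_node v T k : (0 < T)%N -> (k <= T)%N -> pl v T k%:R = v k.
Proof.
move=> T0; rewrite leq_eqVlt => /predU1P[->|kT]; first exact: pl_above.
by rewrite (pl_seg _ kT) ?subrr ?mulr0 ?addr0// lexx lerDl ler01.
Qed.

Lemma plI_node v T k : (0 < T)%N -> (k <= T)%N -> 0 <= v k <= 1 ->
  pt (plI v T (toI (k%:R / T%:R))) = v k.
Proof.
move=> T0 kT vk; rewrite /plI (toIK (grid_itv T0 kT)).
rewrite (mulrC T%:R) divfK ?pnatr_eq0 -?lt0n//.
by rewrite toIK pl_at_node.
Qed.

(** Intermediate value theorem between the two nodes; [H] treats both orders of the values [0] and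
    [1]. *)
Lemma plI_surj v T i j : (0 < T)%N -> (i <= T)%N -> (j <= T)%N ->
  v i = 0 -> v j = 1 -> surj (plI v T).
Proof.
move=> T0 iT jT vi vj p.
have [L L0 HL] := pl_lip v T.
have cpl : continuous (pl v T).
  move=> x; apply/cvgrPdist_lt => e e0; apply/nbhs_ballP; exists (e / L) => /=.
    exact: divr_gt0.
  move=> y; rewrite /ball/= ltr_pdivlMr// mulrC => xy.
  exact: le_lt_trans (HL _ _) xy.
have H a b : (a <= b <= T)%N -> (v a = 0 /\ v b = 1) \/ (v a = 1 /\ v b = 0) ->
    exists s, plI v T s = p.
  move=> /andP[ab bT] vab; have aT := leq_trans ab bT.
  have abR : a%:R <= b%:R :> R by rewrite ler_nat.
  have [||c] := @IVT R (pl v T) a%:R b%:R (pt p) abR.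
  - by apply: continuous_subspaceT => x; exact: cpl.
  - rewrite !pl_at_node//; have := pt_itv p.
    by case: vab => -[-> ->]; rewrite ?(min_l ler01) ?(max_r ler01)
      ?(min_r ler01) ?(max_l ler01).
  rewrite in_itv/= => /andP[ac cb] cp.
  have T0R : 0 < T%:R :> R by rewrite ltr0n.
  have c01 : 0 <= c / T%:R <= 1.
    rewrite divr_ge0 ?(le_trans _ ac)//= ler_pdivrMr// mul1r.
    by rewrite (le_trans cb)// ler_nat.
  exists (toI (c / T%:R)); rewrite /plI (toIK c01).
  by rewrite (mulrC T%:R) divfK ?gt_eqF// cp ptK.
have [ij|ji] := leqP i j; first by apply: (H i j); [rewrite ij|left].
by apply: (H j i); [rewrite ltnW|right].
Qed.

End Interpolation.

(** * Mountain climbing *)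

Section MountainClimbing.
Local Open Scope nat_scope.

Definition adj (i j : nat) : bool := (j == i.+1) || (i == j.+1).

Lemma adjC i j : adj i j = adj j i.
Proof. by rewrite /adj orbC. Qed.

(** A neighbour of [a] is determined by its side. This turns the interior case of [deg_odd] into a
    check on four booleans. *)
Lemma adj_eq a s t : adj a s -> adj a t -> (s == t) = ((s == a.+1) == (t == a.+1)).
Proof. by rewrite /adj; do ![case: eqP => ?]; lia. Qed.

(** The guard [0 < i] cancels the default [i.-1 = 0] at [i = 0]. *)
Lemma sum_adj m (i : 'I_m.+1) (F : nat -> nat) :
  \sum_(i' < m.+1) adj i i' * F i' = (0 < i) * F i.-1 + (i < m) * F i.+1.
Proof.
have sum1 k : \sum_(i' < m.+1) (i' == k :> nat) * F i' = (k <= m) * F k.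
  case: (leqP k m) => [km|mk]; last first.
    by rewrite big1// => j _; case: eqP => // jk; have := ltn_ord j; lia.
  rewrite (bigD1 (Ordinal (km : k < m.+1)))//= eqxx big1 ?addn0// => j jk.
  by case: eqP => // jk'; move/eqP: jk; case; apply: val_inj.
have split_adj (i' : 'I_m.+1) : adj i i' * F i' =
    (i' == i.+1 :> nat) * F i' + (0 < i) * ((i' == i.-1 :> nat) * F i').
  by rewrite /adj; do ![case: eqP]; case: ltnP; lia.
rewrite (eq_bigr _ (fun i' _ => split_adj i')) big_split/= -big_distrr/= !sum1.
by have := ltn_ord i; rewrite ltnS addnC => im; congr (_ * _ + _); case: leqP; lia.
Qed.

Variables (m n N : nat) (p q : nat -> nat).
Hypotheses (N0 : 0 < N) (p0 : p 0 = 0) (pm : p m = N) (q0 : q 0 = 0) (qn : q n = N).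
Hypotheses (pN : forall i, i <= m -> p i <= N) (qN : forall j, j <= n -> q j <= N).
Hypotheses (ps : forall i, i < m -> adj (p i) (p i.+1))
  (qs : forall j, j < n -> adj (q j) (q j.+1)).

(** The vertex condition is part of the relation, so all index pairs can be vertices: those with
    different values are isolated. *)
Definition edge : rel ('I_m.+1 * 'I_n.+1) := fun v w =>
  [&& adj v.1 w.1, adj v.2 w.2, p v.1 == q v.2 & p w.1 == q w.2].

Lemma edge_sym : symmetric edge.
Proof.
move=> v w; rewrite /edge (adjC v.1) (adjC v.2).
by case: adj => //; case: adj => //=; rewrite andbC.
Qed.

Definition deg v := \sum_w edge v w.

Lemma degE (v : 'I_m.+1 * 'I_n.+1) : deg v = (p v.1 == q v.2) *
  ((0 < v.1) * ((0 < v.2) * (p v.1.-1 == q v.2.-1) + (v.2 < n) * (p v.1.-1 == q v.2.+1))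
   + (v.1 < m) * ((0 < v.2) * (p v.1.+1 == q v.2.-1) + (v.2 < n) * (p v.1.+1 == q v.2.+1))).
Proof.
case: v => i j /=; rewrite /deg.
pose G i' := (0 < j) * (p i' == q j.-1) + (j < n) * (p i' == q j.+1).
rewrite -(sum_adj i G) big_distrr/=.
transitivity (\sum_(i' < m.+1) \sum_(j' < n.+1) edge (i, j) (i', j')).
  by rewrite pair_bigA; apply: eq_bigr => -[].
apply: eq_bigr => i' _; rewrite /G.
rewrite -(sum_adj j (fun j' => p i' == q j')) !big_distrr/=.
apply: eq_bigr => j' _; rewrite /edge/=.
by case: adj; case: adj; case: eqP; case: eqP.
Qed.

(** In the interior, if [u] of the two [p]-neighbours and [w] of the two [q]-neighbours lie above
    the common value, the degree is [u w + (2 - u)(2 - w)], which is even. On a side the common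
    value is [0] or [N], so the bounds force all neighbouring values to agree and the degree is [2],
    or [1] at the two matching corners. *)
Lemma deg_odd (v : 'I_m.+1 * 'I_n.+1) :
  odd (deg v) = (v == (ord0, ord0)) || (v == (ord_max, ord_max)).
Proof.
have E0 : (v == (ord0, ord0)) = (v.1 == 0 :> nat) && (v.2 == 0 :> nat) by case: v.
have E1 : (v == (ord_max, ord_max)) = (v.1 == m :> nat) && (v.2 == n :> nat).
  by case: v {E0}.
rewrite E0 E1 degE {E0 E1}; case: v => i j /=.
have := ltn_ord i; have := ltn_ord j; rewrite !ltnS.
move: (nat_of_ord i) (nat_of_ord j) => {}i {}j jn im.
have m0 : 0 < m by case: (m) pm p0; lia.
have n0 : 0 < n by case: (n) qn q0; lia.
have pS : i < m -> adj (p i) (p i.+1) by exact: ps.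
have qS : j < n -> adj (q j) (q j.+1) by exact: qs.
have pP : 0 < i -> adj (p i.-1) (p i).
  by move=> i0; have := @ps i.-1; rewrite prednK//; apply; lia.
have qP : 0 < j -> adj (q j.-1) (q j).
  by move=> j0; have := @qs j.-1; rewrite prednK//; apply; lia.
have pNi := pN im; have qNj := qN jn.
have pNS : i < m -> p i.+1 <= N by exact: pN.
have qNS : j < n -> q j.+1 <= N by exact: qN.
have pNP : p i.-1 <= N by apply: pN; lia.
have qNP : q j.-1 <= N by apply: qN; lia.
have hp0 : i = 0 -> p i = 0 by move=> ->.
have hq0 : j = 0 -> q j = 0 by move=> ->.
have hpm : i = m -> p i = N by move=> ->.
have hqn : j = n -> q j = N by move=> ->.
move: (p i) (p i.+1) (p i.-1) (q j) (q j.+1) (q j.-1) pS pP qS qP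
  pNi qNj pNP qNP pNS qNS hp0 hq0 hpm hqn.
move=> a aS aP b bS bP pS pP qS qP pNi qNj pNP qNP pNS qNS hp0 hq0 hpm hqn.
have [ab|ab] := eqVneq a b; last first.
  by rewrite mul0n; lia.
subst b; rewrite mul1n.
have [i0|i0] := posnP i.
  have im' : i < m by lia.
  rewrite im' mul0n add0n mul1n; move: pS => /(_ im'); rewrite /adj => pS.
  have aS1 : aS = 1 by lia.
  have jn' : j < n by lia.
  rewrite jn' mul1n; move: qS => /(_ jn'); rewrite /adj => qS.
  have bS1 : bS = 1 by lia.
  rewrite aS1 bS1 eqxx i0; have [j0|j0] := posnP j; first by rewrite j0.
  move: qP => /(_ j0); rewrite /adj => qP.
  have -> : bP = 1 by lia.
  by rewrite eqxx/= !ltn_eqF// eq_sym ltn_eqF.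
have [im'|im'] := ltnP i m; last first.
  rewrite mul1n mul0n addn0; move: pP => /(_ i0); rewrite /adj => pP.
  have aPN : aP = N.-1 by lia.
  have j0 : 0 < j by lia.
  rewrite j0 mul1n; move: qP => /(_ j0); rewrite /adj => qP.
  have -> : bP = N.-1 by lia.
  rewrite aPN eqxx; have [jn'|jn'] := ltnP j n; last by rewrite mul0n; lia.
  move: qS => /(_ jn'); rewrite /adj => qS; have -> : bS = N.-1 by lia.
  by rewrite eqxx; lia.
move: pS pP => /(_ im') pS /(_ i0) pP.
rewrite !mul1n.
have [j0|j0] := posnP j.
  have jn' : j < n by lia.
  move: qS pS pP => /(_ jn'); rewrite /adj => qS pS pP.
  have -> : aS = 1 by lia.
  have -> : aP = 1 by lia.
  have -> : bS = 1 by lia.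
  by rewrite jn'; lia.
have [jn'|jn'] := ltnP j n; last first.
  move: qP pS pP => /(_ j0); rewrite /adj => qP pS pP.
  have -> : aS = N.-1 by lia.
  have -> : aP = N.-1 by lia.
  have -> : bP = N.-1 by lia.
  by rewrite !eqxx; lia.
move: qS qP => /(_ jn') qS /(_ j0) qP.
rewrite adjC in pP; rewrite adjC in qP.
rewrite (adj_eq pP qP) (adj_eq pP qS) (adj_eq pS qP) (adj_eq pS qS) !mul1n.
apply: (@etrans _ _ false); last by lia.
by do 4!case: (_ == _.+1).
Qed.

(** Handshake lemma: the first coordinate changes along every edge and so orients it, and the edges
    counted upward match those counted downward. *)
Lemma component_even (C : {set 'I_m.+1 * 'I_n.+1}) :
  (forall v w, v \in C -> edge v w -> w \in C) -> 2 %| \sum_(v in C) deg v.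
Proof.
move=> Cc.
have E v : v \in C -> deg v = \sum_(w in C) (edge v w && (v.1 < w.1)) +
    \sum_(w in C) (edge v w && (w.1 < v.1)).
  move=> vC; rewrite -big_split/= /deg (bigID (mem C))/=.
  rewrite [X in _ + X]big1 ?addn0; last first.
    by move=> w wC; apply/eqP; rewrite eqb0; apply: contra wC; exact: Cc.
  apply: eq_bigr => w _; case e : (edge v w) => //=.
  by move: e => /andP[+ _]; rewrite /adj; case: ltngtP => //; lia.
rewrite (eq_bigr _ E) big_split/= [X in _ + X]exchange_big/=.
rewrite [X in _ + X](_ : _ = \sum_(v in C) \sum_(w in C) (edge v w && (v.1 < w.1))).
  by rewrite addnn dvdn2 odd_double.
by apply: eq_bigr => v _; apply: eq_bigr => w _; rewrite edge_sym.
Qed.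

(** Otherwise the component of the origin would contain exactly one vertex of odd degree. *)
Lemma edge_connect : connect edge (ord0, ord0) (ord_max, ord_max).
Proof.
apply/negPn/negP => nc.
pose C := finset (connect edge (ord0, ord0)).
have Cc v w : v \in C -> edge v w -> w \in C.
  by rewrite !inE => vC e; apply: connect_trans vC _; exact: connect1.
have := component_even Cc.
have C0 : (ord0, ord0) \in C by rewrite inE connect0.
have S2 : 2 %| \sum_(v in C | v != (ord0, ord0)) deg v.
  apply: dvdn_sum => v /andP[vC v0]; rewrite dvdn2 deg_odd (negbTE v0)/=.
  by apply: contra nc => /eqP <-; rewrite inE in vC.
by rewrite (bigD1 _ C0)/= (dvdn_addl _ S2) dvdn2 deg_odd eqxx.
Qed.

Lemma mountain_climbing : exists T (h : nat -> nat * nat),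
  [/\ h 0 = (0, 0), h T = (m, n),
    forall t, t <= T -> [/\ (h t).1 <= m, (h t).2 <= n & p (h t).1 = q (h t).2] &
    forall t, t < T -> adj (h t).1 (h t.+1).1 /\ adj (h t).2 (h t.+1).2].
Proof.
have /connectP[s sp sl] := edge_connect.
pose v0 : 'I_m.+1 * 'I_n.+1 := (ord0, ord0).
pose g t := nth v0 (v0 :: s) t.
have gs t : t < size s -> edge (g t) (g t.+1).
  by move=> ts; have /pathP := sp => /(_ v0 _ ts).
exists (size s), (fun t => (nat_of_ord (g t).1, nat_of_ord (g t).2)); split=> //.
- have -> : g (size s) = (ord_max, ord_max) by rewrite sl /g nth_last.
  by [].
- move=> t ts; split; [exact: ltn_ord (g t).1|exact: ltn_ord (g t).2|].
  (* Equality of heights is read off the edge entering a vertex, which leaves the start to be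
     checked directly. *)
  case: t ts => [|t] ts; first by rewrite /= p0 q0.
  by have /and4P[_ _ _ /eqP] := gs t ts.
- by move=> t /gs/and4P[].
Qed.

End MountainClimbing.

(** * Approximation and amalgamation of surjections *)

Section Discretization.
Variable R : realType.
Notation I := (set_type (@unit_interval R)).
Implicit Types (f g : I -> I) (s t : I) (y : R).

(* Scaling by [N.+1] before truncating makes [rd N] reach [N] already near [1],
   so that a sampled surjection still takes the values [0] and [N]. *)
Definition rd N y := minn N (Num.truncn (N.+1%:R * y)).

Lemma rd_near N y : 0 <= y <= 1 -> `|(rd N y)%:R - N%:R * y| <= 1.
Proof.
move=> /andP[y0 y1].
have h0 : 0 <= N.+1%:R * y by rewrite mulr_ge0.
have /andP[] := truncn_itv h0; rewrite /rd.
set k := Num.truncn _; rewrite -!natr1 mulrDl mul1r => l1 l2.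
rewrite ler_norml; have [kN|Nk] := leqP k N.
  by lra.
have N0 : 0 <= N%:R :> R by [].
have : N%:R + 1 <= k%:R :> R by rewrite natr1 ler_nat.
by move=> Nk'; nra.
Qed.

Lemma rd_eq0 N y : 0 <= y -> y < N.+1%:R^-1 -> rd N y = 0%N.
Proof.
move=> y0 yN; apply/eqP; rewrite -leqn0 /rd geq_min; apply/orP; right.
by rewrite truncn_le_nat mulrC -ltr_pdivlMr ?ltr0n// mul1r.
Qed.

Lemma rd_eqN N y : y <= 1 -> 1 - y < N.+1%:R^-1 -> rd N y = N.
Proof.
move=> y1 yN; apply/minn_idPl.
have N0 : 0 < N.+1%:R :> R by rewrite ltr0n.
have h : N%:R <= N.+1%:R * y.
  move: yN; rewrite -[_^-1]mul1r ltr_pdivlMr//; rewrite -natr1; lra.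
by rewrite truncn_ge_nat// (le_trans _ h).
Qed.

Lemma rd_step N y y' : 0 <= y -> 0 <= y' -> `|y - y'| < N.+1%:R^-1 ->
  (rd N y' <= (rd N y).+1)%N.
Proof.
move=> y0 y'0; have N0 : 0 < N.+1%:R :> R by rewrite ltr0n.
rewrite -[_^-1]mul1r ltr_pdivlMr// => yy'.
have h : N.+1%:R * y' < N.+1%:R * y + 1.
  by have := ler_norm (y' - y); rewrite distrC; nra.
have h0 : 0 <= N.+1%:R * y by rewrite mulr_ge0// ltW.
rewrite /rd -[X in (_ <= X)%N]addn1 addn_minl leq_min.
rewrite (leq_trans (geq_minl _ _)) ?leq_addr//=.
apply: leq_trans (geq_minr _ _) _; rewrite addn1 truncn_le_nat.
have /andP[_ l2] := truncn_itv h0.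
by apply: (lt_trans h); rewrite -[ltRHS]natr1 ltrD2r.
Qed.

Lemma rd_le N y : (rd N y <= N)%N.
Proof. exact: geq_minl. Qed.

Lemma archi_mul_gt (c e : R) : 0 <= c -> 0 < e ->
  exists2 N, (0 < N)%N & c < e * N%:R.
Proof.
move=> c0 e0; exists (Num.bound (c / e)).+1 => //.
rewrite mulrC -ltr_pdivrMr//; apply: lt_trans (archi_boundP _) _.
  by rewrite divr_ge0// ltW.
by rewrite ltr_nat.
Qed.

(** The hypothesis allows equality because consecutive nodes are exactly [1 / M] apart. *)
Definition modulus f (M : nat) (e : R) := forall s t,
  `|pt s - pt t| <= M%:R^-1 -> `|pt (f s) - pt (f t)| < e.

Lemma modulus_ex f e : ucont f -> 0 < e -> exists2 M, (0 < M)%N & modulus f M e.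
Proof.
move=> cf /cf[d d0 df]; exists (Num.bound d^-1).+1 => // s t st.
apply: df; apply: le_lt_trans st _; rewrite invf_plt ?posrE// ?ltr0n//.
by apply: lt_trans (archi_boundP _) _; rewrite ?invr_ge0 ?ltW// ltr_nat.
Qed.

(** * Sampling a surjection as an integer walk *)

Section Samples.
Variables (f : I -> I) (N M : nat).
Hypotheses (M0 : (0 < M)%N) (fM : modulus f M N.+1%:R^-1).

Let MR : 0 < M%:R :> R. Proof. by rewrite ltr0n. Qed.

Definition sample k := rd N (pt (f (toI (k%:R / M%:R)))).

(** One unit of error comes from rounding, the other from the oscillation of [f], which is below
    [1 / N.+1] before scaling by [N]. *)
Lemma sample_near k t : (k <= M)%N -> `|pt t - k%:R / M%:R| <= M%:R^-1 ->
  `|(sample k)%:R - N%:R * pt (f t)| <= 2.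
Proof.
move=> kM tk; have := rd_near N (pt_itv (f (toI (k%:R / M%:R)))).
rewrite -/(sample k).
have : `|pt (toI (k%:R / M%:R)) - pt t| <= M%:R^-1.
  by rewrite (toIK (grid_itv R M0 kM)) distrC.
move=> /fM; set y := pt (f (toI _)); set z := pt (f t) => yz sy.
have zy : `|N%:R * y - N%:R * z| <= 1.
  rewrite -mulrBr normrM ger0_norm//.
  have : N%:R * N.+1%:R^-1 <= 1 :> R by rewrite ler_pdivrMr ?ltr0n// mul1r ler_nat.
  apply: le_trans; apply: ler_wpM2l => //; exact: ltW.
by apply: le_trans (ler_distD (N%:R * y) _ _) _; lra.
Qed.

Lemma sample_le k : (sample k <= N)%N.
Proof. exact: rd_le. Qed.

Lemma sample_step k : (k < M)%N ->
  (sample k.+1 <= (sample k).+1)%N /\ (sample k <= (sample k.+1).+1)%N.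
Proof.
move=> kM.
have E : `|pt (toI (k%:R / M%:R)) - pt (toI (k.+1%:R / M%:R)) : R| <= M%:R^-1.
  rewrite !toIK ?grid_itv// 1?ltnW// -mulrBl -natr1 opprD addrA subrr add0r.
  by rewrite mulN1r normrN ger0_norm// invr_ge0.
have := fM E => fE.
by split; apply: rd_step; rewrite ?pt_ge0// distrC.
Qed.

Lemma sample_hit t : exists2 k, (k <= M)%N &
  `|pt (f t) - pt (f (toI (k%:R / M%:R)))| < N.+1%:R^-1.
Proof.
have [k kM tk] := grid_near t M0; exists k => //.
by apply: fM; rewrite (toIK (grid_itv R M0 kM)) ltW.
Qed.

Lemma sample_surj : surj f ->
  (exists2 k, (k <= M)%N & sample k = 0%N) /\ (exists2 k, (k <= M)%N & sample k = N).
Proof.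
move=> sf; split.
  have [a fa] := sf (toI 0); have [k kM] := sample_hit a.
  rewrite fa toIK ?lexx ?ler01// sub0r normrN => fk; exists k => //.
  by apply: rd_eq0; [exact: pt_ge0|exact: le_lt_trans (ler_norm _) fk].
have [a fa] := sf (toI 1); have [k kM] := sample_hit a.
rewrite fa toIK ?lexx ?ler01// => fk; exists k => //.
by apply: rd_eqN; [exact: pt_le1|exact: le_lt_trans (ler_norm _) fk].
Qed.

(* Halving the time step and doubling the values turns the lazy walk [sample]
   into one whose steps are all exactly [1]. *)
Definition walk i :=
  let k := i./2 in
  if odd i then
    if sample k == sample k.+1 then
      if sample k == N then (sample k).*2.-1 else (sample k).*2.+1
    else (sample k + sample k.+1)%N
  else (sample k).*2.

Lemma walk_double k : walk k.*2 = (sample k).*2.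
Proof. by rewrite /walk odd_double doubleK. Qed.

(** A flat step detours upward, except at the top value [N], where it detours downward to stay
    within [N.*2]. *)
Lemma walk_doubleS k : (0 < N)%N -> (k < M)%N ->
  [/\ adj (sample k).*2 (walk k.*2.+1), adj (walk k.*2.+1) (sample k.+1).*2 &
    (walk k.*2.+1 <= N.*2)%N].
Proof.
move=> N0 kM; rewrite /walk /= odd_double /= uphalf_double /adj.
have := sample_le k; have := sample_le k.+1; have := sample_step kM.
by case: (sample k =P sample k.+1) => ?; [case: (sample k =P N) => ?|] => ? ? ?;
  split; lia.
Qed.

Lemma walk_step i : (0 < N)%N -> (i < M.*2)%N -> adj (walk i) (walk i.+1).
Proof.
move=> N0 iM; have [oi|ei] := boolP (odd i).
  have iE : i = i./2.*2.+1 by have := odd_double_half i; rewrite oi; lia.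
  rewrite iE -doubleS walk_double; have [] := @walk_doubleS i./2 N0 _ => //.
  by lia.
have iE : i = i./2.*2 by have := odd_double_half i; rewrite (negbTE ei); lia.
rewrite iE walk_double; have [] := @walk_doubleS i./2 N0 _ => //.
by lia.
Qed.

Lemma walk_le i : (0 < N)%N -> (i <= M.*2)%N -> (walk i <= N.*2)%N.
Proof.
move=> N0 iM; have [oi|ei] := boolP (odd i).
  have iE : i = i./2.*2.+1 by have := odd_double_half i; rewrite oi; lia.
  by rewrite iE; have [] := @walk_doubleS i./2 N0 _ => //; lia.
have iE : i = i./2.*2 by have := odd_double_half i; rewrite (negbTE ei); lia.
by rewrite iE walk_double leq_double sample_le.
Qed.

(** Doubling the error [2] of the samples gives [4]; an odd time adds one more step. *)
Lemma walk_near i t : (0 < N)%N -> (i <= M.*2)%N ->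
  `|pt t - i%:R / M.*2%:R| <= M.*2%:R^-1 ->
  `|(walk i)%:R - N.*2%:R * pt (f t)| <= 5.
Proof.
move=> N0 iM; have E2 : M.*2%:R^-1 = M%:R^-1 / 2 :> R.
  by rewrite -muln2 natrM invfM.
have c0 : 0 < M%:R^-1 :> R by rewrite invr_gt0.
have EN : N.*2%:R = 2 * N%:R :> R by rewrite -mul2n natrM.
have [oi|ei] := boolP (odd i); last first.
  have iE : i = i./2.*2 by have := odd_double_half i; rewrite (negbTE ei); lia.
  rewrite iE walk_double; set k := i./2 => tk.
  have kM : (k <= M)%N by lia.
  have tk' : `|pt t - k%:R / M%:R| <= M%:R^-1.
    move: tk; rewrite E2 -(mul2n k) natrM.
    have -> : 2 * k%:R * (M%:R^-1 / 2) = k%:R / M%:R :> R by field; rewrite gt_eqF.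
    by lra.
  have := sample_near kM tk'; rewrite -mul2n natrM EN !ler_norml; lra.
have iE : i = i./2.*2.+1 by have := odd_double_half i; rewrite oi; lia.
rewrite iE; set k := i./2 => tk.
have kM : (k < M)%N by lia.
have tk' : `|pt t - k%:R / M%:R| <= M%:R^-1.
  move: tk; rewrite E2 -natr1 -(mul2n k) natrM.
  have -> : (2 * k%:R + 1) * (M%:R^-1 / 2) = k%:R / M%:R + M%:R^-1 / 2 :> R.
    by field; rewrite gt_eqF.
  by rewrite !ler_norml; lra.
have := sample_near (ltnW kM) tk'.
have [+ _ _] := walk_doubleS N0 kM; rewrite /adj.
move: (walk _) (sample k) => w a; rewrite EN -mul2n !ler_norml => /orP[]/eqP E.
  have : w%:R = 2 * a%:R + 1 :> R by rewrite E -[LHS]natr1 natrM.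
  by lra.
have : 2 * a%:R = w%:R + 1 :> R by rewrite natr1 -E natrM.
by lra.
Qed.

End Samples.

Definition close (e : R) f g := forall t, `|pt (f t) - pt (g t)| < e.

(** Density of maps described by finitely many naturals, as (SEP) requires. *)
Lemma plI_approx f e : ucont f -> surj f -> 0 < e ->
  exists M N (l : seq nat), let g := plI (fun k => (nth 0%N l k)%:R / N%:R) M in
    surj g /\ close e f g.
Proof.
(* [3] is the sampling error [2] plus the step, at most [1], between consecutive samples. *)
move=> cf sf e0; have [N N0' Ne] := @archi_mul_gt 3 e (ler0n _ _) e0.
have N0 : 0 < N%:R :> R by rewrite ltr0n.
have [|M M0 fM] := @modulus_ex f N.+1%:R^-1 cf; first by rewrite invr_gt0 ltr0n.
exists M, N, (mkseq (sample f N M) M.+1) => g.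
have vE k : (k <= M)%N -> nth 0%N (mkseq (sample f N M) M.+1) k = sample f N M k.
  by move=> kM; rewrite nth_mkseq.
have [[i iM si] [j jM sj]] := sample_surj M0 fM sf.
split.
  apply: (plI_surj M0 iM jM); rewrite vE//; first by rewrite si mul0r.
  by rewrite sj divff// gt_eqF.
move=> t; have [k kM tk] := seg_index t M0.
have v01 r : (r <= M)%N ->
    0 <= ((nth 0%N (mkseq (sample f N M) M.+1) r)%:R / N%:R : R) <= 1.
  by move=> rM; rewrite vE//; apply: grid_itv => //; exact: sample_le.
rewrite (plI_seg v01 kM tk) !vE// 1?ltnW//.
set l := M%:R * pt t - _; have l01 : 0 <= l <= 1 by rewrite /l; lra.
have MR : 0 < M%:R :> R by rewrite ltr0n.
have tk' : `|pt t - k%:R / M%:R| <= M%:R^-1.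
  have -> : pt t - k%:R / M%:R = l / M%:R by rewrite /l; field; rewrite gt_eqF.
  rewrite normrM ger0_norm; last by case/andP: l01.
  by rewrite ger0_norm ?invr_ge0// ler_piMl ?invr_ge0//; case/andP: l01.
have := sample_near M0 fM (ltnW kM) tk'.
have [] := sample_step M0 fM kM; rewrite -!(ler_nat R) -!natr1.
move: (sample f N M k) (sample f N M k.+1) (pt (f t)) => a b y ba ab.
move=> ay; rewrite -(ltr_pM2r N0) -[X in _ * X < _](ger0_norm (ltW N0)) -normrM.
have -> : (y - (a%:R / N%:R + (b%:R / N%:R - a%:R / N%:R) * l)) * N%:R =
    N%:R * y - a%:R - (b%:R - a%:R) * l by field; rewrite gt_eqF.
apply: le_lt_trans Ne; move: ay l01; rewrite !ler_norml => /andP[? ?] /andP[? ?].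
by apply/andP; split; nra.
Qed.

(** [g1] and [g2] interpolate the two coordinates of a synchronized climb of the walks of [f1] and
    [f2]. They are onto because the climb joins opposite corners. *)
Lemma amalgamate_ends f1 f2 e : ucont f1 -> ucont f2 ->
  f1 (toI 0) = toI 0 -> f1 (toI 1) = toI 1 ->
  f2 (toI 0) = toI 0 -> f2 (toI 1) = toI 1 -> 0 < e ->
  exists g1 g2, [/\ ucont g1 /\ surj g1, ucont g2 /\ surj g2 &
    close e (f1 \o g1) (f2 \o g2)].
Proof.
(* Each walk is within [5] of its map scaled by [N.*2], so the two maps differ by at most
   [10 / (2 N) = 5 / N]. *)
move=> c1 c2 f10 f11 f20 f21 e0; have [N N0 Ne] := @archi_mul_gt 5 e (ler0n _ _) e0.
have NR : 0 < N%:R :> R by rewrite ltr0n.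
have iN : 0 < N.+1%:R^-1 :> R by rewrite invr_gt0 ltr0n.
have [M1 M10 fM1] := modulus_ex c1 iN; have [M2 M20 fM2] := modulus_ex c2 iN.
have w0 f M : f (toI 0) = toI 0 -> walk f N M 0 = 0%N.
  move=> f0; rewrite (walk_double f N M 0) /sample mul0r f0 rd_eq0//.
    by rewrite toIK ?lexx ?ler01.
  by rewrite toIK ?lexx ?ler01.
have w1 f M : (0 < M)%N -> f (toI 1) = toI 1 -> walk f N M M.*2 = N.*2.
  move=> M0 ft; rewrite walk_double /sample divff ?pnatr_eq0 -?lt0n// ft rd_eqN//.
    by rewrite toIK ?lexx ?ler01.
  by rewrite toIK ?lexx ?ler01// subrr.
have [|||||||||T [h [h0 hT hb hs]]] := @mountain_climbing M1.*2 M2.*2 N.*2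
    (walk f1 N M1) (walk f2 N M2).
- by rewrite double_gt0.
- exact: w0.
- exact: w1.
- exact: w0.
- exact: w1.
- by move=> i; exact: walk_le.
- by move=> i; exact: walk_le.
- by move=> i; exact: walk_step.
- by move=> i; exact: walk_step.
have T0 : (0 < T)%N by case: T hT {hb hs} => //; rewrite h0 => -[]; lia.
have D1 : (0 < M1.*2)%N by rewrite double_gt0.
have D2 : (0 < M2.*2)%N by rewrite double_gt0.
have D1R : M1.*2%:R != 0 :> R by rewrite pnatr_eq0 -lt0n.
have D2R : M2.*2%:R != 0 :> R by rewrite pnatr_eq0 -lt0n.
exists (plI (fun i => (h i).1%:R / M1.*2%:R) T), (plI (fun i => (h i).2%:R / M2.*2%:R) T).
split.
- split; first exact: plI_ucont.
  by apply: (plI_surj T0 (leq0n T) (leqnn T)); rewrite ?h0 ?hT/= ?mul0r ?divff.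
- split; first exact: plI_ucont.
  by apply: (plI_surj T0 (leq0n T) (leqnn T)); rewrite ?h0 ?hT/= ?mul0r ?divff.
move=> t; have [k kT tk] := seg_index t T0.
(* Within a segment the position moves by at most one index from the left node, as [walk_near]
   demands. *)
have node (u : nat -> nat) m : (0 < m)%N -> (forall i, (i <= T)%N -> (u i <= m)%N) ->
    adj (u k) (u k.+1) ->
    `|pt (plI (fun i => (u i)%:R / m%:R) T t) - (u k)%:R / m%:R| <= m%:R^-1.
  move=> m0 um uk; rewrite (@plI_seg R _ T k t)//; last first.
    by move=> i iT; apply: grid_itv => //; exact: um.
  have mR : 0 < m%:R :> R by rewrite ltr0n.
  set l := _ - k%:R; have l01 : 0 <= l <= 1 by rewrite /l; lra.
  rewrite addrAC subrr add0r -mulrBl mulrAC normrM.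
  rewrite (ger0_norm (_ : 0 <= m%:R^-1)) ?invr_ge0//.
  rewrite ler_piMl ?invr_ge0// normrM (ger0_norm (_ : 0 <= l)); last by case/andP: l01.
  case/orP: uk => /eqP ->; rewrite -natr1.
    by rewrite addrAC subrr add0r normr1 mul1r; case/andP: l01.
  by rewrite opprD addrA subrr add0r normrN normr1 mul1r; case/andP: l01.
have kT' := ltnW kT; have [b1 b2 pq] := hb k kT'; have [s1 s2] := hs k kT.
have := walk_near M10 fM1 N0 b1 (node (fun i => (h i).1) _ D1 _ s1).
have := walk_near M20 fM2 N0 b2 (node (fun i => (h i).2) _ D2 _ s2).
move=> /(_ (fun i iT => let: And3 _ hi _ := hb i iT in hi)) n2.
move=> /(_ (fun i iT => let: And3 hi _ _ := hb i iT in hi)) n1.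
move: n1 n2; rewrite /= -/(plI _ _ _) pq -mul2n natrM.
move: (pt (f1 _)) (pt (f2 _)) (walk f2 _ _ _)%:R => y z w n1 n2.
rewrite -(ltr_pM2r NR) -[X in _ * X < _](ger0_norm (ltW NR)) -normrM.
apply: le_lt_trans Ne; move: n1 n2; rewrite !ler_norml => /andP[? ?] /andP[? ?].
by apply/andP; split; lra.
Qed.

Lemma amalgamate f1 f2 e : ucont f1 -> surj f1 -> ucont f2 -> surj f2 -> 0 < e ->
  exists g1 g2, [/\ ucont g1 /\ surj g1, ucont g2 /\ surj g2 &
    close e (f1 \o g1) (f2 \o g2)].
Proof.
move=> c1 s1 c2 s2 e0.
(* The path [a, 0, 1, b] with [f a = 0] and [f b = 1] covers [I]. *)
have ends f : surj f -> exists h, [/\ ucont h, surj h,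
    f (h (toI 0)) = toI 0 & f (h (toI 1)) = toI 1].
  move=> sf; have [a fa] := sf (toI 0); have [b fb] := sf (toI 1).
  pose v k : R := nth 0 [:: pt a; 0; 1; pt b] k.
  exists (plI v 3); split; first exact: plI_ucont.
  - exact: (@plI_surj R v 3 1 2).
  - have -> : plI v 3 (toI 0) = a; last exact: fa.
    apply: pt_inj; have := @plI_node R v 3 0 isT isT (pt_itv a).
    by rewrite mul0r.
  - have -> : plI v 3 (toI 1) = b; last exact: fb.
    apply: pt_inj; have := @plI_node R v 3 3 isT isT (pt_itv b).
    by rewrite divff.
have [h1 [ch1 sh1 h10 h11]] := ends _ s1; have [h2 [ch2 sh2 h20 h21]] := ends _ s2.
have [g1 [g2 [[cg1 sg1] [cg2 sg2] g12]]] := amalgamate_ends (ucont_comp c1 ch1)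
  (ucont_comp c2 ch2) h10 h11 h20 h21 e0.
exists (h1 \o g1), (h2 \o g2); split=> //; split.
- exact: ucont_comp.
- exact: surj_comp.
- exact: ucont_comp.
- exact: surj_comp.
Qed.

End Discretization.

(** * The Fraisse property *)

Section OneObject.
Variables (S : pomType) (P : (S -> S) -> Prop).

Inductive one_object_hom : forall A B : pomType, (A -> B) -> Prop :=
  OneObjectHom f : P f -> @one_object_hom S S f.

Lemma one_object_hom_ob (A B : pomType) (f : A -> B) :
  one_object_hom f -> A = S /\ B = S.
Proof. by case. Qed.

Lemma one_object_homE (f : S -> S) : one_object_hom f -> P f.
Proof.
(* Case analysis needs variable end points; the map is transported along [eA] and [eB], which proof
   irrelevance turns into [erefl]. *)
suff H (A B : pomType) (g : A -> B) : one_object_hom g ->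
    forall (eA : A = S) (eB : B = S),
    P (match eA in _ = A', eB in _ = B' return A' -> B' with erefl, erefl => g end).
  by move=> /H /(_ erefl erefl).
case=> {}g Pg eA eB.
by rewrite (Prop_irrelevance eA erefl) (Prop_irrelevance eB erefl).
Qed.

End OneObject.

Section Fraisse.
Variable R : realType.
Notation I := (set_type (@unit_interval R)).
Notation S := (LscI R).
Implicit Types (a b : S -> S) (f g h : I -> I).

Lemma KP_homE (A B : pomType) (f : A -> B) : KP_hom R f <->
  one_object_hom (fun a : S -> S =>
    order_embedding a /\ a (lsc_cst R _ 1) = lsc_cst R _ 1) f.
Proof. by split=> -[{}f]; [split|case; split]. Qed.

Lemma KP_hom_ob (A B : pomType) (f : A -> B) : KP_hom R f -> A = S /\ B = S.
Proof. by move=> /KP_homE/one_object_hom_ob. Qed.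

Lemma KP_hom_pull f : ucont f -> surj f -> KP_hom R (pull f).
Proof. by move=> cf sf; split; [exact: pull_embedding|exact: pull_cst]. Qed.

Lemma KP_hom_dual a : KP_hom R a -> exists f, [/\ ucont f, surj f & a = pull f].
Proof.
move=> /KP_homE/one_object_homE[ae a1]; exists (dual ae a1).
split; [exact: dual_ucont|exact: dual_surj|apply/funext => x].
by apply: lv_eq => k t; rewrite (lv_pull _ _ _ (dual_ucont ae a1)); exact: lv_dual.
Qed.

Lemma order_embedding_comp (A B C : pomType) (f : A -> B) (g : B -> C) :
  order_embedding f -> order_embedding g -> order_embedding (g \o f).
Proof.
move=> [[f0 fD fl fw fs] fe] [[g0 gD gl gw gs] ge]; split; last by move=> x y /ge/fe.
split=> [|x y|x y /fl/gl|x y /fw/gw|u s nu us]//=; first by rewrite f0.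
  by rewrite fD gD.
by apply: (gs (f \o u)); [move=> m n /nu/fl|exact: fs].
Qed.

Lemma order_embedding_id (A : pomType) : order_embedding (@id A).
Proof. by split. Qed.

Lemma KP_hom_id : KP_hom R (@id S).
Proof. by split=> //; exact: order_embedding_id. Qed.

Lemma KP_hom_comp a b : KP_hom R a -> KP_hom R b -> KP_hom R (b \o a).
Proof.
move=> /KP_homE/one_object_homE[ae a1] /KP_homE/one_object_homE[be b1].
by split; [exact: order_embedding_comp|rewrite /= a1].
Qed.

Lemma KP_subcategory : cu_subcategory (KP R).
Proof.
split=> [A ->|A B f|A ->|A B C f g fh gh] /=.
- exact: LscI_cu_semigroup.
- by case=> {}f [fm _] _.
- exact: KP_hom_id.
- have [EA EB] := KP_hom_ob fh; have [_ EC] := KP_hom_ob gh; subst A B C.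
  exact: KP_hom_comp.
Qed.

(** The gap between [x'] and [x] absorbs the distance between [f t] and [g t]. *)
Lemma cu_eq_on_close (F : set S) e f g :
  (forall x' x, F x' -> F x -> way_below x' x -> gap e x' x) ->
  ucont f -> ucont g -> close e f g -> cu_eq_on F (pull f) (pull g).
Proof.
move=> Fe cf cg fg x' x Fx' Fx /(Fe _ _ Fx' Fx) gx.
split; apply/lsc_leP => k t; rewrite !lv_pull//; apply: gx => //.
by rewrite distrC.
Qed.

Lemma pull_comp f g : ucont f -> ucont g -> pull g \o pull f = pull (f \o g).
Proof.
move=> cf cg; apply/funext => x; apply: lv_eq => k t.
by rewrite !lv_pull//; exact: ucont_comp.
Qed.

Lemma KP_NAP : NAP (KP R).
Proof.
move=> A B1 B2 a1 a2 F h1 h2 Ffin.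
have [EA E1] := KP_hom_ob h1; have [_ E2] := KP_hom_ob h2; subst A B1 B2.
have [f1 [c1 s1 E1]] := KP_hom_dual h1; have [f2 [c2 s2 E2]] := KP_hom_dual h2.
have [e e0 Fe] := finite_gap Ffin.
have [g1 [g2 [[cg1 sg1] [cg2 sg2] g12]]] := amalgamate c1 s1 c2 s2 e0.
exists S, (pull g1), (pull g2); split=> //; [exact: KP_hom_pull..|].
rewrite E1 E2 !pull_comp//.
by apply: cu_eq_on_close Fe _ _ g12; exact: ucont_comp.
Qed.

(** A code [(T, N, l)] has breakpoints [k / T] with values [l_k / N]. *)
Definition code_map (c : nat * nat * seq nat) : I -> I :=
  plI (fun k => (nth 0%N c.2 k)%:R / c.1.2%:R) c.1.1.

(** Words make closure under composition immediate, without showing that composites of coded maps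
    are again coded. *)
Definition word_map (w : seq (nat * nat * seq nat)) : S -> S :=
  foldr (fun c a => pull (code_map c) \o a) id w.

Definition is_word_map a := exists2 w,
  (forall c, c \in w -> surj (code_map c)) & a = word_map w.

Definition KQ : subcat := Subcat (fun A => A = S) (one_object_hom is_word_map).

Lemma word_map_cat w w' : word_map (w ++ w') = word_map w \o word_map w'.
Proof. by elim: w => //= c w ->. Qed.

Lemma is_word_map_KP a : is_word_map a -> KP_hom R a.
Proof.
move=> [w ws ->]; elim: w ws => [_|c w IH ws] /=; first exact: KP_hom_id.
apply: KP_hom_comp; first by apply: IH => d dw; apply: ws; rewrite inE dw orbT.
by apply: KP_hom_pull; [exact: plI_ucont|apply: ws; rewrite inE eqxx].
Qed.

Lemma KQ_le_KP : subcat_le KQ (KP R).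
Proof. by split=> //= A B f [{}f]; exact: is_word_map_KP. Qed.

Lemma KQ_subcategory : cu_subcategory KQ.
Proof.
split=> [A|A B f|A ->|A B C f g fh gh] /=.
- exact: (subcat_ob KP_subcategory).
- by move=> /KQ_le_KP.2; exact: (subcat_hom KP_subcategory).
- by split; exists [::].
- have [EA EB] := one_object_hom_ob fh; have [_ EC] := one_object_hom_ob gh.
  subst A B C; split; have [w ws ->] := one_object_homE fh.
  have [w' ws' ->] := one_object_homE gh; exists (w' ++ w).
    by move=> c; rewrite mem_cat => /orP[/ws'|/ws].
  by rewrite word_map_cat.
Qed.

Lemma KQ_countable : countably_many_morphisms KQ.
Proof.
(* All words are enumerated, whether or not their letters are surjective; an integer coding no word
   yields the identity. *)
exists (fun n => existT _ S (existT _ S (word_map (odflt [::] (unpickle n))))).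
by move=> A B f [{}f [w _ ->]]; exists (pickle w); rewrite pickleK.
Qed.

Lemma KP_SEP : SEP (KP R).
Proof.
exists KQ; split.
- by split; [exact: KQ_subcategory|exact: KQ_le_KP].
- by move=> A ->; exact: LscI_countably_based.
- exact: KQ_countable.
- by move=> A ->; exists S, id; split=> //; exact: KP_hom_id.
move=> B A sigma F _ hs Ffin; have [EB EA] := KP_hom_ob hs; subst A B.
have [f [cf sf ->]] := KP_hom_dual hs; have [e e0 Fe] := finite_gap Ffin.
have [M [N [l [sg fg]]]] := plI_approx cf sf e0.
(* The target already lies in the subcategory, so [alpha] is the identity and a one-letter word
   approximates [sigma]. *)
exists S, id, (pull (code_map (M, N, l))); split=> //.
  by split; exists [:: (M, N, l)] => // c; rewrite inE => /eqP ->.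
by apply: cu_eq_on_close Fe cf _ fg; exact: plI_ucont.
Qed.

End Fraisse.

Theorem theorem4p35 (R : realType) : fraisse_category (KP R).
Proof.
split; [exact: KP_subcategory| |exact: KP_NAP|exact: KP_SEP].
move=> A1 A2 -> ->; exists (LscI R); split=> //; exists id; exact: KP_hom_id.
Qed.
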